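(* Each of the eight power series $f_1,\dots,f_8$ defined by $$f_1(q)=\sum_{n\ge0}\frac{q^{\frac{n^2+n}{2}}(q)_{2n}}{(-q)_n(q)_{2n+1}},\quad f_2(q)=\sum_{n\ge1}\frac{q^{\frac{n^2+n}{2}}(q)_{2n-2}}{(-q)_{n-1}(q)_{2n-1}},\quad f_3(q)=\sum_{n\ge0}\frac{(q)_{2n}}{(-q)_{2n+1}}q^n,$$ $$f_4(q)=\sum_{n\ge0}\frac{(q)_{2n+1}}{(-q)_{2n+2}}q^{n+1},\quad f_5(q)=\sum_{n\ge0}(-1)^n\frac{(q)_n}{(q;q^2)_{n+1}}q^{\frac{n^2+n}{2}},\quad f_6(q)=\sum_{n\ge1}(-1)^n\frac{(q)_{n-1}(q^2;q^2)_{n-1}}{(q)_{2n-1}}q^n,$$ $$f_7(q)=\sum_{n\ge0}(-1)^n\frac{q^{n^2+n}(q^2;q^2)_n}{(-q)_{2n+1}},\quad f_8(q)=\sum_{n\ge1}\frac{(q)_{2n-1}}{(q^{2n};q^2)_n}q^n$$ is lacunary.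
   Context: The $f_i$ are regarded as formal power series in $q$. Notation: $(a;q)_n:=\prod_{j=0}^{n-1}(1-aq^j)$ and $(a)_n:=(a;q)_n$; a second argument $q^2$ means $q$ is replaced by $q^2$ in this definition, i.e. $(a;q^2)_n=\prod_{j=0}^{n-1}(1-aq^{2j})$. A power series $\sum_{n\ge0}a(n)q^n$ is called lacunary if its coefficients are almost always zero, i.e. $\lim_{X\to\infty}\frac1X\#\{0\le n\le X: a(n)\neq0\}=0$. *)

(* Defs.v *)
From HB Require Import structures.
From mathcomp Require Import all_boot all_order all_algebra.
From mathcomp Require Import all_classical all_reals all_analysis.

Set Implicit Arguments.
Unset Strict Implicit.
Unset Printing Implicit Defensive.

Import Order.TTheory GRing.Theory Num.Theory.
Import numFieldNormedType.Exports.

Local Open Scope classical_set_scope.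
Local Open Scope ring_scope.

(* Formal power series over a commutative ring: [coef f n] is the coefficient
   of q^n in f. *)
Record fps (R : Type) := Fps { coef : nat -> R }.

HB.instance Definition _ (R : Type) := gen_eqMixin (fps R).
HB.instance Definition _ (R : Type) := gen_choiceMixin (fps R).

Lemma fpsP (R : Type) (f g : fps R) : coef f =1 coef g -> f = g.
Proof. by case: f g => [f] [g] /= /funext ->. Qed.

Section FpsZmodule.
Variable R : zmodType.
Implicit Types f g h : fps R.

Definition fps_zero : fps R := Fps (fun=> 0).
Definition fps_opp f : fps R := Fps (fun n => - coef f n).
Definition fps_add f g : fps R := Fps (fun n => coef f n + coef g n).

Fact fps_addA : associative fps_add.
Proof. by move=> f g h; apply: fpsP => n /=; rewrite addrA. Qed.

Fact fps_addC : commutative fps_add.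
Proof. by move=> f g; apply: fpsP => n /=; rewrite addrC. Qed.

Fact fps_add0 : left_id fps_zero fps_add.
Proof. by move=> f; apply: fpsP => n /=; rewrite add0r. Qed.

Fact fps_addN : left_inverse fps_zero fps_opp fps_add.
Proof. by move=> f; apply: fpsP => n /=; rewrite addNr. Qed.

HB.instance Definition _ :=
  GRing.isZmodule.Build (fps R) fps_addA fps_addC fps_add0 fps_addN.

Lemma coef0 n : coef (0 : fps R) n = 0. Proof. by []. Qed.
Lemma coefN f n : coef (- f) n = - coef f n. Proof. by []. Qed.
Lemma coefD f g n : coef (f + g) n = coef f n + coef g n. Proof. by []. Qed.

Lemma coef_sum (I : Type) (r : seq I) (P : pred I) (F : I -> fps R) n :
  coef (\sum_(i <- r | P i) F i) n = \sum_(i <- r | P i) coef (F i) n.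
Proof. by elim/big_rec2: _ => // i _ f _ <-. Qed.

End FpsZmodule.

Section FpsComRing.
Variable R : comNzRingType.
Implicit Types f g h : fps R.

Definition fps_one : fps R := Fps (fun n => (n == 0)%:R).
Definition fps_mul f g : fps R :=
  Fps (fun n => \sum_(i < n.+1) coef f i * coef g (n - i)).

(* The truncation of a series, used to transfer the ring laws from {poly R}. *)
Definition fps_trunc m f : {poly R} := \poly_(i < m) coef f i.

Lemma coef_fps_mul f g m n : (n < m)%N ->
  coef (fps_mul f g) n = (fps_trunc m f * fps_trunc m g)`_n.
Proof.
move=> nm; rewrite coefM; apply: eq_bigr => -[i] /=; rewrite ltnS => le_in _.
rewrite !coef_poly (leq_ltn_trans le_in nm).
by rewrite (leq_ltn_trans (leq_subr _ _) nm).
Qed.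

Fact fps_mulC : commutative fps_mul.
Proof.
by move=> f g; apply: fpsP => n; rewrite !(@coef_fps_mul _ _ n.+1)// mulrC.
Qed.

Fact fps_mulA : associative fps_mul.
Proof.
have E f g h n : coef (fps_mul f (fps_mul g h)) n =
    (fps_trunc n.+1 f * (fps_trunc n.+1 g * fps_trunc n.+1 h))`_n.
  rewrite coefM; apply: eq_bigr => -[i] /=; rewrite ltnS => le_in _.
  rewrite coef_poly ltnS le_in; congr (_ * _).
  by rewrite -coef_fps_mul// ltnS leq_subr.
move=> f g h; apply: fpsP => n.
by rewrite [fps_mul (fps_mul f g) h]fps_mulC !E mulrA mulrC.
Qed.

Fact fps_mul1 : left_id fps_one fps_mul.
Proof.
move=> f; apply: fpsP => n /=; rewrite big_ord_recl /= mul1r subn0.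
by rewrite big1 ?addr0// => i _; rewrite mul0r.
Qed.

Fact fps_mulDl : left_distributive fps_mul +%R.
Proof.
move=> f g h; apply: fpsP => n /=; rewrite -big_split /=.
by apply: eq_bigr => i _; rewrite mulrDl.
Qed.

Fact fps_one_neq0 : fps_one != 0.
Proof.
by apply/eqP => /(congr1 (fun f => coef f 0)) /= /eqP; rewrite oner_eq0.
Qed.

HB.instance Definition _ := GRing.Zmodule_isComNzRing.Build (fps R)
  fps_mulA fps_mulC fps_mul1 fps_mulDl fps_one_neq0.

Lemma coef1 n : coef (1 : fps R) n = (n == 0)%:R. Proof. by []. Qed.

Lemma coefM f g n :
  coef (f * g) n = \sum_(i < n.+1) coef f i * coef g (n - i).
Proof. by []. Qed.

Lemma coefM0 f g : coef (f * g) 0 = coef f 0 * coef g 0.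
Proof. by rewrite coefM big_ord1. Qed.

End FpsComRing.

(* f is invertible exactly when its constant term c is; the coefficients b_n of
   the inverse are then determined by c b_0 = 1 and, for n > 0,
   c b_n = - \sum_(i < n) b_i f_(n - i). *)
Section FpsUnit.
Variable R : comUnitRingType.
Implicit Types f g : fps R.

Definition fps_unit : {pred fps R} := [pred f | coef f 0 \is a GRing.unit].

(* The list [:: b_0; ...; b_(m-1)]. *)
Fixpoint fps_inv_seq f (m : nat) : seq R :=
  if m is n.+1 then
    let s := fps_inv_seq f n in
    rcons s ((coef f 0)^-1 *
      ((n == 0)%:R - \sum_(i < n) s`_i * coef f (n - i)))
  else [::].

Definition fps_inv_coef f (n : nat) : R := (fps_inv_seq f n.+1)`_n.

Definition fps_inv f : fps R :=
  if f \in fps_unit then Fps (fps_inv_coef f) else f.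

Lemma size_fps_inv_seq f m : size (fps_inv_seq f m) = m.
Proof. by elim: m => //= m IH; rewrite size_rcons IH. Qed.

Lemma nth_fps_inv_seq f m n : (n < m)%N ->
  (fps_inv_seq f m)`_n = (fps_inv_seq f n.+1)`_n.
Proof.
elim: m => // m IH; rewrite ltnS leq_eqVlt => /predU1P[-> //|nm].
by rewrite [LHS]/= nth_rcons size_fps_inv_seq nm IH.
Qed.

Fact fps_mulVf : {in fps_unit, left_inverse 1 fps_inv *%R}.
Proof.
move=> f uf; apply: fpsP => n; rewrite /fps_inv uf coefM big_ord_recr /= subnn.
have -> : \sum_(i < n) fps_inv_coef f i * coef f (n - i) =
    \sum_(i < n) (fps_inv_seq f n)`_i * coef f (n - i).
  by apply: eq_bigr => i _; rewrite /fps_inv_coef -(@nth_fps_inv_seq _ n).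
rewrite /fps_inv_coef /= nth_rcons size_fps_inv_seq ltnn eqxx mulrAC mulVr//.
by rewrite mul1r addrC subrK.
Qed.

Fact fps_unitPl f g : g * f = 1 -> fps_unit f.
Proof.
move=> /(congr1 (fun h => coef h 0)); rewrite coefM0 coef1 /= => gf1.
by apply/unitrPr; exists (coef g 0); rewrite mulrC.
Qed.

Fact fps_inv_out : {in [predC fps_unit], fps_inv =1 id}.
Proof. by move=> f; rewrite inE /fps_inv => /negbTE ->. Qed.

HB.instance Definition _ := GRing.ComNzRing_hasMulInverse.Build (fps R)
  fps_mulVf fps_unitPl fps_inv_out.

Lemma unit_fpsE f : (f \is a GRing.unit) = (coef f 0 \is a GRing.unit).
Proof. by []. Qed.

End FpsUnit.

(* The formal sum of the t_n over n >= m: its q^k-coefficient is the value at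
   which the q^k-coefficients of the partial sums stabilise (0 by default). *)
Definition fps_sum (R : comNzRingType) (m : nat) (t : nat -> fps R) : fps R :=
  Fps (fun k => xget 0 [set c | exists N, forall M, (N <= M)%N ->
                                  coef (\sum_(m <= n < M) t n) k = c]).

(* A family whose n-th member is divisible by q^n is summable. *)
Lemma coef_fps_sum (R : comNzRingType) m (t : nat -> fps R) k M :
  (forall n j, (m <= n)%N -> (j < n)%N -> coef (t n) j = 0) -> (k < M)%N ->
  coef (fps_sum m t) k = \sum_(m <= n < M) coef (t n) k.
Proof.
move=> t0; have stab : forall M, (k < M)%N ->
    coef (\sum_(m <= n < M) t n) k = coef (\sum_(m <= n < k.+1) t n) k.
  elim=> // M' IH; rewrite ltnS leq_eqVlt => /predU1P[<- //|kM].
  have [mM|Mm] := leqP m M'; last first.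
    by rewrite !big_geq// (leq_trans kM)// ltnW.
  by rewrite big_nat_recr//= IH// t0// addr0.
move=> kM; rewrite -coef_sum stab//; apply: xget_unique.
  by exists k.+1 => N; exact: stab.
move=> c [N Nc]; rewrite -(Nc (maxn N k.+1)) ?leq_maxl//.
by rewrite stab// leq_maxr.
Qed.

Definition fps_X (R : comNzRingType) : fps R := Fps (fun n => (n == 1)%:R).

Lemma coef_fps_XnM (R : comNzRingType) (f : fps R) m k :
  coef (fps_X R ^+ m * f) k = if (k < m)%N then 0 else coef f (k - m).
Proof.
elim: m k => [|m IH] k; first by rewrite mul1r subn0.
rewrite exprS -mulrA coefM big_ord_recl /= mulr0n mul0r add0r.
case: k => [|k]; first by rewrite big_ord0.
rewrite big_ord_recl mulr1n mul1r [X in _ + X]big1 => [|i _]; last exact: mul0r.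
rewrite addr0 -coefM.
by rewrite (_ : (k.+1 - _)%N = k) ?IH// /bump subSS subn0.
Qed.

(* The q-Pochhammer symbol (a; q)_n. *)
Definition qpoch (S : comNzRingType) (a q : S) (n : nat) : S :=
  \prod_(j < n) (1 - a * q ^+ j).

Lemma coef_qpoch0 (R : comNzRingType) (a p : fps R) n :
  coef a 0 = 0 -> coef (qpoch a p n) 0 = 1.
Proof.
move=> a0; rewrite /qpoch; elim/big_rec: _ => // j f _ f0.
by rewrite coefM0 f0 mulr1 coefD coefN coefM0 a0 mul0r subr0.
Qed.

Lemma qpoch_unit (R : comUnitRingType) (a p : fps R) n :
  coef a 0 = 0 -> qpoch a p n \is a GRing.unit.
Proof. by move=> a0; rewrite unit_fpsE coef_qpoch0// unitr1. Qed.

(* The natural density of the support of f is 0. *)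
Definition lacunary (K : realType) (R : comNzRingType) (f : fps R) : Prop :=
  (fun X : nat => #|[set n : 'I_X.+1 | coef f n != 0]%SET|%:R / X%:R : K)
    @ \oo --> (0 : K).

Local Notation q := (fps_X int).

Definition f1 : fps int := fps_sum 0 (fun n =>
  q ^+ ((n ^ 2 + n) %/ 2) * qpoch q q (2 * n)
  / (qpoch (- q) q n * qpoch q q (2 * n + 1))).

Definition f2 : fps int := fps_sum 1 (fun n =>
  q ^+ ((n ^ 2 + n) %/ 2) * qpoch q q (2 * n - 2)
  / (qpoch (- q) q (n - 1) * qpoch q q (2 * n - 1))).

Definition f3 : fps int := fps_sum 0 (fun n =>
  qpoch q q (2 * n) / qpoch (- q) q (2 * n + 1) * q ^+ n).

Definition f4 : fps int := fps_sum 0 (fun n =>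
  qpoch q q (2 * n + 1) / qpoch (- q) q (2 * n + 2) * q ^+ (n + 1)).

Definition f5 : fps int := fps_sum 0 (fun n =>
  (-1) ^+ n * (qpoch q q n / qpoch q (q ^+ 2) (n + 1))
  * q ^+ ((n ^ 2 + n) %/ 2)).

Definition f6 : fps int := fps_sum 1 (fun n =>
  (-1) ^+ n * (qpoch q q (n - 1) * qpoch (q ^+ 2) (q ^+ 2) (n - 1)
               / qpoch q q (2 * n - 1)) * q ^+ n).

Definition f7 : fps int := fps_sum 0 (fun n =>
  (-1) ^+ n * (q ^+ (n ^ 2 + n) * qpoch (q ^+ 2) (q ^+ 2) n
               / qpoch (- q) q (2 * n + 1))).

Definition f8 : fps int := fps_sum 1 (fun n =>
  qpoch q q (2 * n - 1) / qpoch (q ^+ (2 * n)) (q ^+ 2) n * q ^+ n).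

(* Main.v *)
Require Import Defs.
From mathcomp Require Import all_boot all_order all_algebra.
From mathcomp Require Import all_classical all_reals all_analysis.
From mathcomp Require Import ring lra zify.
Import Defs.

Set Implicit Arguments.
Unset Strict Implicit.
Unset Printing Implicit Defensive.

Import Order.TTheory GRing.Theory Num.Theory.
Import numFieldNormedType.Exports.

Local Open Scope ring_scope.

(** The coefficients of the eight series are supported on norms.  Each series is
    a sum, over a cone of lattice points and with signs, of powers q^n whose
    exponent satisfies x^2 - D y^2 = c (A n + B) for integers x and y, with
    D = 2 for the first four series, D = 3 for the last four, and c = 1, -1, 2
    or -2.  A prime p that is inert in Q(sqrt D) and divides a norm
    x^2 - D y^2 divides both x and y, so p^2 divides the norm.  Hence a nonzero
    coefficient at n forces A n + B to be divisible by no inert prime exactly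
    once.  The sum of 1/p over inert primes diverges, so almost no integer has
    this property.

    The double sums come from Bailey's transform.  Every summand has the form
    c (p)_m w_m(u) b_m, with p = q or p = q^2, with w_m(u) the product of the
    u - p^(s+1+i) over i < m, and with b_m one of five sequences.  Each of the
    five is the right member of a Bailey pair, b_m being the sum over r of
    a_r / ((p)_{m-r} (p)_{m+r+s+1}), where a_r is, up to elementary factors, a
    finite theta sum ([pair_tri], [pair_mix1], [pair_mix2], [pair_sq],
    [pair_sq1]); both members satisfy the same recurrence of order one in m, and
    for the sums over r the recurrence reduces to a telescoping sum
    ([telescope_pair]).  Summing over m first leaves a q-Gauss sum, evaluated in
    [conj_bailey_pair] with an explicit remainder; [supp_bailey] passes to the
    limit.

    Divergence over inert primes follows from comparing two bounds
    ([inert_prod]).  Let chi be the character of Q(sqrt D), with divisor sums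
    rep(n).  Since rep is nonnegative, and counts all divisors of n when all
    prime factors of n split, the square of the sum of 1/n over such n <= y is
    at most the sum of rep(n)/n over n <= y^2, which is at most the harmonic sum
    H(y^2) because the partial sums of chi(d)/d are bounded.  If few primes were
    inert, the left side would have order H(y)^2, which is larger.  The Chinese
    remainder theorem turns the divergence into density zero
    ([sieve_density]).  That chi(p) = -1 makes D a nonresidue modulo p is
    shown by descent for D = 2 and D = 3 ([nonres8], [nonres12]). *)

(** * Bailey pairs and a q-Gauss sum *)

Section BaileyTransform.
Variables (R : comUnitRingType) (p : R).

Definition iqpoch k : R := (qpoch p p k)^-1.

(** 1/(p;p)_(m-r), which is zero for r > m: with this value the end points of
    the telescoping sums below contribute nothing. *)
Definition iqpochB m r : R := if (r <= m)%N then iqpoch (m - r) else 0.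

(** The kernel of Bailey pairs relative to a = p^s, up to the factor (p;p)_s
    that turns (ap;p)_(m+r) into (p;p)_(m+r+s). *)
Definition bailey_kernel s m r : R := iqpochB m r * iqpoch (m + r + s).

Definition bailey_pair s (a b : nat -> R) :=
  forall m, b m = \sum_(r < m.+1) a r * bailey_kernel s m r.

(** This is u^m (p^s/u;p)_m, in a form that makes sense for u = 0, where it is
    the limiting weight (-1)^m p^(s m + m(m-1)/2). *)
Definition hpoch s (u : R) m : R := \prod_(i < m) (u - p ^+ (s + i)).

(** The value of the q-Gauss sum over m of (p;p)_m, [hpoch s.+1 u m] and the
    kernel, as a function of r. *)
Definition bailey_gamma u s r : R :=
  qpoch p p r * hpoch s.+1 u r * iqpoch (r + s) * (qpoch u p r.+1)^-1.

Lemma qpochS (a x : R) k : qpoch a x k.+1 = qpoch a x k * (1 - a * x ^+ k).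
Proof. by rewrite /qpoch big_ord_recr. Qed.

Lemma hpochS s u m : hpoch s u m.+1 = hpoch s u m * (u - p ^+ (s + m)).
Proof. by rewrite /hpoch big_ord_recr. Qed.

Hypothesis up : forall k, 1 - p ^+ k.+1 \is a GRing.unit.

Lemma unit_qpoch k : qpoch p p k \is a GRing.unit.
Proof.
elim: k => [|k IH]; first by rewrite /qpoch big_ord0 unitr1.
by rewrite qpochS unitrM IH -exprS up.
Qed.

Lemma iqpoch0 : iqpoch 0 = 1.
Proof. by rewrite /iqpoch /qpoch big_ord0 invr1. Qed.

Lemma iqpochS k : iqpoch k = iqpoch k.+1 * (1 - p ^+ k.+1).
Proof.
by rewrite /iqpoch qpochS -exprS invrM ?unit_qpoch// mulrAC mulVr ?up// mul1r.
Qed.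

Lemma iqpochB0 r k : iqpochB (r + k) r = iqpoch k.
Proof. by rewrite /iqpochB leq_addr addKn. Qed.

Lemma iqpochB1 r k : iqpochB (r + k) r.+1 = (1 - p ^+ k) * iqpoch k.
Proof.
rewrite /iqpochB; case: k => [|k]; first by rewrite addn0 ltnn expr0 subrr mul0r.
by rewrite -addSnnS leq_addr addKn mulrC -iqpochS.
Qed.

Lemma iqpochB_pred m r k : m.+1 = (r + k)%N -> iqpochB m r = (1 - p ^+ k) * iqpoch k.
Proof.
case: k => [|k] E; last first.
  have -> : m = (r + k)%N by lia.
  by rewrite iqpochB0 mulrC -iqpochS.
rewrite /iqpochB; case: leqP => [|_]; first by lia.
by rewrite expr0 subrr mul0r.
Qed.

Lemma iqpochB_lt m r : (m < r)%N -> iqpochB m r = 0.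
Proof. by move=> mr; rewrite /iqpochB leqNgt mr. Qed.

Lemma bailey_kernel_lt s m r : (m < r)%N -> bailey_kernel s m r = 0.
Proof. by move=> mr; rewrite /bailey_kernel iqpochB_lt// mul0r. Qed.

(** The right member of a Bailey pair satisfies a recurrence of order one as soon
    as the summands of the recurrence form a telescoping sequence.  The unit v
    clears the denominator of the certificate W. *)
Lemma telescope_pair s (a W : nat -> R) m (v c d : R) :
    v \is a GRing.unit -> W 0 = 0 -> W m.+2 = 0 ->
    (forall r k, m.+1 = (r + k)%N ->
       v * (a r * (c * bailey_kernel s m.+1 r - d * bailey_kernel s m r)) = W r - W r.+1) ->
  c * (\sum_(r < m.+2) a r * bailey_kernel s m.+1 r) =
  d * (\sum_(r < m.+1) a r * bailey_kernel s m r).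
Proof.
move=> uv W0 Wm E; apply/eqP; rewrite -subr_eq0.
have -> : \sum_(r < m.+1) a r * bailey_kernel s m r = \sum_(r < m.+2) a r * bailey_kernel s m r.
  by rewrite [RHS]big_ord_recr/= (bailey_kernel_lt _ (ltnSn m)) mulr0 addr0.
rewrite !mulr_sumr -sumrB; apply/eqP; apply: (mulrI uv); rewrite mulr0 mulr_sumr.
rewrite (eq_bigr (fun r : 'I_m.+2 => - (W r.+1 - W r))).
  rewrite sumrN -(big_mkord xpredT (fun r => W r.+1 - W r)) telescope_sumr//.
  by rewrite W0 Wm subrr oppr0.
move=> [r /= rm] _; rewrite opprB -(E r (m.+1 - r)%N) ?subnKC//.
by congr (v * _); ring.
Qed.

Lemma bailey_pair_ind s (a b c d : nat -> R) :
    b 0 = a 0 * bailey_kernel s 0 0 ->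
    (forall m, c m \is a GRing.unit) ->
    (forall m, c m * b m.+1 = d m * b m) ->
    (forall m, c m * (\sum_(r < m.+2) a r * bailey_kernel s m.+1 r) =
       d m * (\sum_(r < m.+1) a r * bailey_kernel s m r)) ->
  bailey_pair s a b.
Proof.
move=> b0 uc bS aS; elim=> [|m IH]; first by rewrite big_ord1.
by apply: (mulrI (uc m)); rewrite bS aS IH.
Qed.

(** The sum telescopes because 1 - u is the difference of 1 - p^(s+1+m) and
    u - p^(s+1+m). *)
Lemma conj_bailey_pair0 s u M :
  (1 - u) * (\sum_(m < M) qpoch p p m * hpoch s.+1 u m * bailey_kernel s.+1 m 0) =
  iqpoch s - hpoch s.+1 u M * iqpoch (M + s).
Proof.
elim: M => [|M IH].
  by rewrite big_ord0 mulr0 /hpoch big_ord0 mul1r subrr.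
rewrite big_ord_recr/= mulrDr IH /bailey_kernel.
rewrite -[X in iqpochB X 0]add0n iqpochB0 addn0 hpochS !addnS !addSn (iqpochS (M + s)).
have E : qpoch p p M * iqpoch M = 1 by rewrite mulrV ?unit_qpoch.
rewrite (addnC s M).
by ring: E.
Qed.

(** The certificate G passes from one value of r to the next in the q-Gauss
    sum. *)
Lemma conj_bailey_pair_step s u r m :
  let t r := qpoch p p m * hpoch s.+1 u m * bailey_kernel s.+1 m r in
  let G m := (1 - p ^+ (r + r + s).+2) * qpoch p p m * hpoch s.+1 u m *
     bailey_kernel s.+1 m r.+1 * (1 - p ^+ (m + r + s).+2) in
  (1 - p ^+ (r + s).+1) * (1 - u * p ^+ r.+1) * t r.+1
   - (1 - p ^+ r.+1) * (u - p ^+ (r + s).+1) * t r = G m - G m.+1.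
Proof.
move=> t G; rewrite /t /G; have [mr|/subnKC <-] := ltnP m r.
  by rewrite !bailey_kernel_lt ?ltnS// ?(ltnW mr)//; ring.
set k := (m - r)%N; clearbody k; rewrite /bailey_kernel iqpochB1 iqpochB0.
have -> : iqpochB (r + k).+1 r.+1 = iqpoch k by rewrite -addSn iqpochB0.
rewrite qpochS hpochS.
set P := qpoch p p _; set w := hpoch _ _ _; set a := iqpoch k.
have -> : (r + k + r + s.+1 = (r + k + r + s).+1)%N by lia.
have -> : (r + k + r.+1 + s.+1 = (r + k + r + s).+2)%N by lia.
have -> : ((r + k).+1 + r.+1 + s.+1 = (r + k + r + s).+3)%N by lia.
have -> : (((r + k).+1 + r + s).+2 = (r + k + r + s).+3)%N by lia.
rewrite (iqpochS (r + k + r + s).+1) (iqpochS (r + k + r + s).+2).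
set b := iqpoch _; rewrite !addSn !exprS !exprD; ring.
Qed.

(** The remainder after M terms is a multiple of [hpoch s.+1 u M]; for power
    series p and u without constant term that factor is divisible by q^M.  The
    conclusion is a sigma type, so that the cofactors can be collected over all
    r in the next lemma. *)
Lemma conj_bailey_pair s u r M : (forall k, 1 - u * p ^+ k \is a GRing.unit) ->
  {h | \sum_(m < M) qpoch p p m * hpoch s.+1 u m * bailey_kernel s.+1 m r =
    bailey_gamma u s r + hpoch s.+1 u M * h}.
Proof.
move=> uu; rewrite /bailey_gamma; elim: r => [|r [h IH]].
  have u1 : 1 - u \is a GRing.unit by have := uu 0%N; rewrite expr0 mulr1.
  exists (- (1 - u)^-1 * iqpoch (M + s)); apply: (mulrI u1).
  rewrite conj_bailey_pair0 mulrDr {1}/qpoch big_ord0 {2}/hpoch big_ord0 /qpoch big_ord1.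
  have E : (1 - u) * (1 - u)^-1 = 1 by rewrite mulrV.
  rewrite expr0 mulr1 add0n; set i := _^-1 in E *; set d := 1 - u in E *; clearbody i d; ring: E.
have uS k : qpoch u p k \is a GRing.unit.
  by elim: k => [|k H]; rewrite ?qpochS ?unitrM ?H ?uu// /qpoch big_ord0 unitr1.
pose v := (1 - p ^+ (r + s).+1) * (1 - u * p ^+ r.+1).
have uv : v \is a GRing.unit by rewrite unitrM up uu.
pose g := (1 - p ^+ (r + r + s).+2) * qpoch p p M *
     bailey_kernel s.+1 M r.+1 * (1 - p ^+ (M + r + s).+2).
exists (v^-1 * ((1 - p ^+ r.+1) * (u - p ^+ (r + s).+1) * h - g)).
apply: (mulrI uv).
have /eqP := telescope_sumr (fun m => (1 - p ^+ (r + r + s).+2) * qpoch p p m *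
  hpoch s.+1 u m * bailey_kernel s.+1 m r.+1 * (1 - p ^+ (m + r + s).+2)) (leq0n M).
rewrite big_mkord (bailey_kernel_lt _ (ltn0Sn r)) mulr0 mul0r subr0.
under eq_bigr do rewrite -opprB -conj_bailey_pair_step.
rewrite sumrN sumrB -!mulr_sumr IH eqr_oppLR => /eqP/(canRL (subrK _)) ->.
rewrite (qpochS p p r) (hpochS _ u r) (qpochS u p r.+1) (invrM (uS _) (uu _)).
have E1 : v * v^-1 = 1 by rewrite mulrV.
rewrite (_ : (s.+1 + r = (r + s).+1)%N); last by lia.
rewrite -exprS (iqpochS (r + s)) !addSn /g.
have E2 : (1 - u * p ^+ r.+1) * (1 - u * p ^+ r.+1)^-1 = 1 by rewrite mulrV.
move: E1; set iv := v^-1; clearbody iv; rewrite /v.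
set j := _^-1 in E2 *; set d := 1 - u * _ in E2 *; set c := 1 - p ^+ (r + s).+1.
clearbody j d c => E1; rewrite [RHS]mulrDr.
rewrite [c * d * (_ * _)](_ : _ = d * j * (c * (qpoch p p r * (1 - p ^+ r.+1) *
  (hpoch s.+1 u r * (u - p ^+ (r + s).+1)) * iqpoch (r + s).+1 / qpoch u p r.+1)));
  last by ring.
rewrite E2 [c * d * _](_ : _ = c * d * iv * (hpoch s.+1 u M *
  ((1 - p ^+ r.+1) * (u - p ^+ (r + s).+1) * h -
     (1 - p ^+ (r + r + s).+2) * qpoch p p M * bailey_kernel s.+1 M r.+1 *
     (1 - p ^+ (M + r + s).+2)))); last by ring.
by rewrite E1; ring.
Qed.

(** Exchanging the sums over m and r reduces the left side to q-Gauss sums. *)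
Lemma bailey_transform s u (a b : nat -> R) M :
    (forall k, 1 - u * p ^+ k \is a GRing.unit) -> bailey_pair s.+1 a b ->
  exists h, \sum_(m < M) qpoch p p m * hpoch s.+1 u m * b m =
    \sum_(r < M) a r * bailey_gamma u s r + hpoch s.+1 u M * h.
Proof.
move=> uu ab.
have -> : \sum_(m < M) qpoch p p m * hpoch s.+1 u m * b m =
  \sum_(r < M) a r * \sum_(m < M) qpoch p p m * hpoch s.+1 u m * bailey_kernel s.+1 m r.
  under [RHS]eq_bigr do rewrite mulr_sumr.
  rewrite exchange_big/=; apply: eq_bigr => m _; rewrite ab mulr_sumr.
  pose F r := a r * (qpoch p p m * hpoch s.+1 u m * bailey_kernel s.+1 m r).
  rewrite -(big_mkord xpredT F) (big_cat_nat (n := m.+1))//= [X in _ + X]big_nat_cond.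
  rewrite [X in _ + X]big1 ?addr0 => [|r]; last first.
    by rewrite andbT => /andP[mr _]; rewrite /F bailey_kernel_lt// !mulr0.
  by rewrite big_mkord; apply: eq_bigr => r _; rewrite mulrCA.
exists (\sum_(r < M) a r * sval (conj_bailey_pair s r M uu)).
rewrite mulr_sumr -big_split/=; apply: eq_bigr => r _.
by case: (conj_bailey_pair s r M uu) => h /= ->; rewrite mulrDr; congr (_ + _); exact: mulrCA.
Qed.

(** * Five Bailey pairs *)

(** p^(r^2) times the sum of p^(-j(j+1)/2) over |j| <= r.  The recursion keeps
    all exponents nonnegative. *)
Fixpoint theta_tri r : R := if r is r'.+1 then
   p ^+ (2 * r').+1 * theta_tri r' + p ^+ 'C(r'.+2, 2) + p ^+ 'C(r'.+1, 2) else 1.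

Definition alpha_tri r := (-1) ^+ r * p ^+ r * theta_tri r.

(** The recurrence for theta sums telescopes up to the two terms that
    [theta_tri r] adds to [theta_tri r.-1]; an alternating sum of q-binomial
    coefficients, which telescopes as well, absorbs these. *)
Lemma pair_tri : bailey_pair 1 alpha_tri (fun m => (qpoch p (p ^+ 2) m.+1)^-1).
Proof.
have u2 m : qpoch p (p ^+ 2) m \is a GRing.unit.
  elim: m => [|m H]; first by rewrite /qpoch big_ord0 unitr1.
  by rewrite qpochS unitrM H -exprM -exprS up.
apply: (@bailey_pair_ind _ _ _ (fun m => 1 - p ^+ (2 * m.+1).+1) (fun=> 1)).
- by rewrite /alpha_tri /bailey_kernel (iqpochB0 0 0)
  iqpoch0 /iqpoch /qpoch !big_ord1 !expr0 !mul1r !mulr1.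
- by move=> m; exact: up.
- move=> m; rewrite (qpochS p _ m.+1) invrM// -?exprM -?exprS ?up//.
  by rewrite mulrA mulrV ?up.
move=> m; pose n := m.+1.
pose e r := (-1) ^+ r * p ^+ 'C(r, 2) * (iqpochB n r * iqpoch (m + r)).
(* V r is theta_tri r without its two new terms; for r = 0 these are 1 + 1, in
   excess of theta_tri 0 = 1, hence the value -1. *)
pose V r := if r is r'.+1 then p ^+ (2 * r').+1 * theta_tri r' else -1.
pose W r := (1 - p ^+ n) * p ^+ n * (-1) ^+ r * (iqpochB n r * iqpoch (n + r)) * V r
            + p ^+ n * e r.
apply: (@telescope_pair 1 alpha_tri W m (1 - p ^+ n)).
- exact: up.
- rewrite /W /e /= /iqpochB /= !subn0 !addn0 (iqpochS m); ring.
- by rewrite /W /e iqpochB_lt// !(mul0r, mulr0) addr0.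
move=> r k E; rewrite /alpha_tri /W /e -/n.
have -> : theta_tri r = (V r + p ^+ 'C(r.+1, 2)) + p ^+ 'C(r,2).
  by case: {E} r => [|r] /=; rewrite ?expr0; ring.
have -> : V r.+1 = p ^+ (2 * r).+1 * (V r + p ^+ 'C(r.+1, 2) + p ^+ 'C(r, 2)).
  by case: {E} r => [|r] /=; rewrite ?expr0; ring.
rewrite /n E iqpochB0 iqpochB1 /bailey_kernel iqpochB0 (iqpochB_pred E).
have -> : (r + k + r.+1 = (r + k + r).+1)%N by lia.
have -> : (r + k + r + 1 = (r + k + r).+1)%N by lia.
have -> : (m + r + 1 = r + k + r)%N by lia.
have -> : (m + r.+1 = r + k + r)%N by lia.
rewrite (iqpochS (m + r)) (_ : (m + r).+1 = r + k + r)%N; last by lia.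
rewrite (iqpochS (r + k + r)) (_ : (2 * (r + k)).+1 = r + k + r + k.+1)%N; last by lia.
rewrite (_ : 2 * r = r + r)%N; last by lia.
rewrite (binS r 1) bin1; move: (V r) (iqpoch _) (iqpoch _) => v i j.
rewrite !exprS !exprD !exprS; set y := p ^+ r; set z := p ^+ k; set B := p ^+ 'C(r, 2).
ring.
Qed.

Lemma iqpochB2 r k : iqpochB (r + k) r.+2 = (1 - p ^+ k) * (1 - p ^+ k.-1) * iqpoch k.
Proof.
case: k => [|k]; first by rewrite iqpochB_lt ?addn0// expr0 subrr !mul0r.
by rewrite -addSnnS iqpochB1 (iqpochS k) /=; ring.
Qed.

Lemma iqpochB3 r k :
  iqpochB (r + k) r.+3 = (1 - p ^+ k) * (1 - p ^+ k.-1) * (1 - p ^+ k.-2) * iqpoch k.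
Proof.
case: k => [|k]; first by rewrite iqpochB_lt; [rewrite expr0 subrr !mul0r|lia].
by rewrite -addSnnS iqpochB2 (iqpochS k) /=; ring.
Qed.

Definition antidiag c r : R := \sum_(i < r.+1) p ^+ (c * i * (r - i)).

Lemma antidiag0 c : antidiag c 0 = 1.
Proof. by rewrite /antidiag big_ord1 muln0 expr0. Qed.

Lemma antidiag1 c : antidiag c 1 = 2.
Proof. by rewrite /antidiag big_ord_recl big_ord1 /= !muln0 !expr0. Qed.

(** In the sum over i + j = r + 2, the end terms are 1, and the others are
    reindexed by i j = (i-1)(j-1) + r + 1. *)
Lemma antidiagSS c r : antidiag c r.+2 = 2 + p ^+ (c * r.+1) * antidiag c r.
Proof.
rewrite /antidiag big_ord_recl big_ord_recr/= muln0 subnn muln0 expr0 mulr_sumr.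
rewrite [RHS]addrC -[2]/(1 + 1) addrCA; congr (_ + _).
apply: eq_bigr => -[i /= ir] _; rewrite -exprD /bump/=.
congr (p ^+ _); rewrite add1n subSS -(subnKC (ir : i <= r)%N).
by rewrite -addnS !addKn; ring.
Qed.

Definition alpha_mix1 r := (-1) ^+ r * (1 - p ^+ (r.+1 + r.+1)) * p ^+ 'C(r.+1, 2) * antidiag 1 r.

(** By [antidiagSS], weights C with step two in r give the telescoping part; the
    constant 2 in that recurrence leaves a multiple of the alternating q-binomial
    sum of [pair_tri]. *)
Lemma pair_mix1 : bailey_pair 2 alpha_mix1 (fun m => qpoch p p m / qpoch p p (2 * m).+1).
Proof.
have up1 m : 1 + p ^+ m.+1 \is a GRing.unit.
  have := up (m + m).+1; rewrite (_ : (m + m).+2 = m.+1 + m.+1)%N; last by lia.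
  rewrite (_ : 1 - _ = (1 + p ^+ m.+1) * (1 - p ^+ m.+1)); last by rewrite exprD; ring.
  by rewrite unitrM => /andP[].
apply: (@bailey_pair_ind _ _ _ (fun m => (1 + p ^+ m.+1) * (1 - p ^+ (2 * m.+1).+1)) (fun=> 1)).
- rewrite /alpha_mix1 /bailey_kernel (iqpochB0 0 0) iqpoch0 antidiag0 muln0 -/(iqpoch 1)
  (iqpochS 1) /qpoch big_ord0.
  rewrite !add0n /= !expr0. by ring.
- by move=> m; rewrite unitrM up1 up.
- move=> m; rewrite -!/(iqpoch _) mulnS !addSn add0n (iqpochS (2 * m).+1) (iqpochS (2 * m).+2).
  move: (iqpoch _) => i; rewrite qpochS (_ : (2 * m).+2 = m.+1 + m.+1)%N; last by lia.
  by rewrite !(exprS, exprD); ring.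
move=> m; pose n := m.+1.
pose e r := (-1) ^+ r * p ^+ 'C(r, 2) * (iqpochB n r * iqpoch (m + r)).
pose C r := p ^+ n * (-1) ^+ r * p ^+ 'C(r, 2) * (1 + p ^+ r) * (iqpochB n r * iqpoch (n + r)).
pose W r := (1 - p ^+ n) * ((antidiag 1 r - 2) * C r + (antidiag 1 r.+1 - 2) * C r.+1)
  + 2 * p ^+ n * e r.
apply: (@telescope_pair 2 alpha_mix1 W m (1 - p ^+ n)).
- exact: up.
- rewrite /W /e /C antidiag0 antidiag1 /= /iqpochB /= !subn0 !addn0 (iqpochS m); ring.
- by rewrite /W /e /C ![iqpochB n _]iqpochB_lt ?(leqW (ltnSn _))// !(mul0r, mulr0) !addr0 ?mulr0.
move=> r k E; rewrite /alpha_mix1 /W /e /C antidiagSS /n E iqpochB0 iqpochB1 iqpochB2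
  /bailey_kernel iqpochB0 (iqpochB_pred E).
have -> : (r + k + r.+2 = (r + k + r).+2)%N by lia.
have -> : (r + k + r.+1 = (r + k + r).+1)%N by lia.
have -> : (r + k + r + 2 = (r + k + r).+2)%N by lia.
have -> : (m + r + 2 = (r + k + r).+1)%N by lia.
have -> : (m + r.+1 = r + k + r)%N by lia.
rewrite (iqpochS (m + r)) (_ : (m + r).+1 = r + k + r)%N; last by lia.
rewrite (iqpochS (r + k + r)) (iqpochS (r + k + r).+1).
rewrite (_ : (2 * (r + k)).+1 = r + k + r + k.+1)%N; last by lia.
rewrite (binS r.+1 1) (binS r 1) !bin1 mul1n;
  move: (antidiag 1 r) (antidiag 1 r.+1) (iqpoch _) (iqpoch _) => t t' i j.
case: k {E} => [|k].
  rewrite addn0 expr0 !(exprS, exprD) expr0; ring.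
rewrite !(exprS, exprD) /= ?(exprS, exprD); set y := p ^+ r; set z := p ^+ k;
  set B := p ^+ 'C(r, 2).
ring.
Qed.

Definition alpha_mix2 r := (1 - p ^+ (r.+1 + r.+1)) * ((-1) ^+ r * antidiag 2 r).

Definition beta_mix2 m := (-1) ^+ m / (qpoch (p ^+ 2) (p ^+ 2) m * (1 - p ^+ (2 * m).+1)).

(** As for [pair_mix1]: the sequences e and f make the two-step differences of
    [antidiagSS] telescope, and subtracting 2 from [antidiag 2 r.+1] accounts for
    its constant. *)
Lemma pair_mix2 : bailey_pair 2 alpha_mix2 beta_mix2.
Proof.
have up2 m : qpoch (p ^+ 2) (p ^+ 2) m \is a GRing.unit.
  elim: m => [|m H]; first by rewrite /qpoch big_ord0 unitr1.
  by rewrite qpochS unitrM H -exprS -exprM mulnS up.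
apply: (@bailey_pair_ind _ _ _
   (fun m => (1 - p ^+ (m.+1 + m.+1)) * (1 - p ^+ (2 * m.+1).+1))
   (fun m => - (1 - p ^+ (2 * m).+1))).
- rewrite /alpha_mix2 /beta_mix2 /bailey_kernel (iqpochB0 0 0)
  iqpoch0 antidiag0 muln0 /qpoch big_ord0 /= !add0n !mul1r.
  rewrite mulr1 expr1 /iqpoch !qpochS /qpoch big_ord0 mul1r expr0 mulr1 -expr2.
  by rewrite invrM ?(up 1) ?(up 0)// mulrA mulrV ?(up 1)// mul1r.
- by move=> m; rewrite unitrM !up.
- move=> m; rewrite /beta_mix2 qpochS -exprS -exprM.
  rewrite !invrM ?unitrM ?up2 ?up ?mulnS ?up//.
  have E1 : (1 - p ^+ (2 * m).+1) * (1 - p ^+ (2 * m).+1)^-1 = 1 by rewrite mulrV ?up.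
  have E2 : (1 - p ^+ (2 * m).+2) * (1 - p ^+ (2 * m).+2)^-1 = 1 by rewrite mulrV ?up.
  have E3 : (1 - p ^+ (2 * m).+3) * (1 - p ^+ (2 * m).+3)^-1 = 1 by rewrite mulrV ?up.
  rewrite (_ : m.+1 + m.+1 = (2 * m).+2)%N; last by lia.
  rewrite [(-1) ^+ _.+1]exprS !addSn !add0n.
  transitivity (- (-1) ^+ m * (qpoch (p ^+ 2) (p ^+ 2) m)^-1); last first.
    rewrite [RHS](_ : _ = - (-1) ^+ m * (qpoch (p ^+ 2) (p ^+ 2) m)^-1 *
      ((1 - p ^+ (2 * m).+1) * (1 - p ^+ (2 * m).+1)^-1)); last by ring.
    by rewrite E1 mulr1.
  rewrite [LHS](_ : _ = - (-1) ^+ m * (qpoch (p ^+ 2) (p ^+ 2) m)^-1 *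
    ((1 - p ^+ (2 * m).+2) * (1 - p ^+ (2 * m).+2)^-1) *
    ((1 - p ^+ (2 * m).+3) * (1 - p ^+ (2 * m).+3)^-1)); last by ring.
  by rewrite E2 E3 !mulr1.
move=> m; pose n := m.+1.
pose e r := iqpochB n r.+1 * iqpoch (n + r).
pose f r := iqpochB n r * iqpoch (m + r).
pose W r := (-1) ^+ r * (antidiag 2 r * (e r + f r) - (antidiag 2 r.+1 - 2) * e r.+1
  - antidiag 2 r.+1 * e r).
apply: (@telescope_pair 2 alpha_mix2 W m 1).
- exact: unitr1.
- rewrite /W /e /f antidiag0 antidiag1 /= /iqpochB /= subn0 subSS subn0 !addn0; ring.
- by rewrite /W /e /f !iqpochB_lt; (lia || ring).
move=> r k E; rewrite /alpha_mix2 /W /e /f antidiagSS /n E.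
rewrite iqpochB0 iqpochB1 iqpochB2 iqpochB3 /bailey_kernel iqpochB0 (iqpochB_pred E).
have -> : (r + k + r.+2 = (r + k + r).+2)%N by lia.
have -> : (r + k + r.+1 = (r + k + r).+1)%N by lia.
have -> : (r + k + r + 2 = (r + k + r).+2)%N by lia.
have -> : (m + r + 2 = (r + k + r).+1)%N by lia.
have -> : (m + r.+1 = r + k + r)%N by lia.
rewrite (iqpochS (m + r)) (_ : (m + r).+1 = r + k + r)%N; last by lia.
rewrite (iqpochS (r + k + r)) (iqpochS (r + k + r).+1).
rewrite (_ : (2 * (r + k)).+1 = (m + m).+3)%N; last by lia.
rewrite (_ : (2 * m).+1 = (m + m).+1)%N; last by lia.
move: (antidiag 2 r) (antidiag 2 r.+1) (iqpoch _) (iqpoch _) => t t' i j.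
case: k E => [|[|k]] E.
- have -> : r = m.+1 by lia.
  rewrite addn0 !(exprS, exprD) expr0; ring.
- have -> : r = m by lia.
  rewrite addn1 /= !(exprS, exprD) expr0; ring.
have -> : m = (r + k.+1)%N by lia.
rewrite /= !(exprS, exprD, mulSn) !mul0n; set y := p ^+ r; set z := p ^+ k.
ring.
Qed.

(** The identity behind the change of s is
    (1 - p^(2r+2)) K_2(m,r) = K_1(m,r) - p^(2r+2) K_1(m,r+1). *)
Lemma bailey_pair_lower a b :
    bailey_pair 2 (fun r => (1 - p ^+ (r.+1 + r.+1)) * a r) b ->
  bailey_pair 1 (fun r => a r - (if r is r'.+1 then p ^+ (r + r) * a r' else 0)) b.
Proof.
move=> ab m; rewrite ab.
under [RHS]eq_bigr do rewrite mulrBl.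
rewrite sumrB [X in _ - X]big_ord_recl /= mul0r add0r.
transitivity (\sum_(r < m.+1)
  (a r * bailey_kernel 1 m r - p ^+ (r.+1 + r.+1) * a r * bailey_kernel 1 m r.+1)).
  apply: eq_bigr => -[r /= rm] _; rewrite /bailey_kernel -(subnKC (rm : (r <= m)%N)).
  rewrite iqpochB0 iqpochB1; set k := (m - r)%N.
  have -> : (r + k + r + 2 = (r + k + r).+2)%N by lia.
  have -> : (r + k + r + 1 = (r + k + r).+1)%N by lia.
  have -> : (r + k + r.+1 + 1 = (r + k + r).+2)%N by lia.
  by rewrite (iqpochS (r + k + r).+1) !(exprS, exprD); ring.
by rewrite sumrB [X in _ - X = _]big_ord_recr/= bailey_kernel_lt// mulr0 addr0.
Qed.

Lemma pair_mix2_lower : bailey_pair 1 (fun r => (-1) ^+ r * antidiag 2 r -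
  (if r is r'.+1 then p ^+ (r + r) * ((-1) ^+ r' * antidiag 2 r') else 0)) beta_mix2.
Proof. exact: (@bailey_pair_lower (fun r => (-1) ^+ r * antidiag 2 r) _ pair_mix2). Qed.
End BaileyTransform.

Section BaseSquare.
Variables (R : comUnitRingType) (q : R).
Let p := q ^+ 2.
Hypothesis uq : forall k, 1 - p ^+ k.+1 \is a GRing.unit.

Lemma unit1q m : 1 + q ^+ m.+1 \is a GRing.unit.
Proof.
have := uq m; rewrite -exprM mul2n -addnn.
rewrite (_ : 1 - _ = (1 + q ^+ m.+1) * (1 - q ^+ m.+1)); last by rewrite exprD; ring.
by rewrite unitrM => /andP[].
Qed.

Lemma unit_qpochN m : qpoch (- q) q m \is a GRing.unit.
Proof.
elim: m => [|m H]; first by rewrite /qpoch big_ord0 unitr1.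
by rewrite qpochS unitrM H mulNr opprK -exprS unit1q.
Qed.

Lemma qpochNSV m : (1 + q ^+ m.+1) * (qpoch (- q) q m.+1)^-1 = (qpoch (- q) q m)^-1.
Proof.
by rewrite qpochS mulNr opprK -exprS invrM ?unit_qpochN ?unit1q// mulVKr ?unit1q.
Qed.

(** q^(r^2) times the sum of (-1)^j q^(-j^2) over |j| <= r. *)
Fixpoint theta_sq r : R := if r is r'.+1 then
   q ^+ (2 * r').+1 * theta_sq r' + 2 * (-1) ^+ r else 1.

Definition alpha_sq r := q ^+ (r * r.+1) * (1 - q ^+ (2 * r).+1) * theta_sq r.

(** The certificate has the shape of the one of [pair_tri], in base q^2. *)
Lemma pair_sq : bailey_pair p 1 alpha_sq (fun m => (qpoch (- q) q (2 * m).+1)^-1).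
Proof.
have iqS := iqpochS uq.
apply: (@bailey_pair_ind _ _ _ _ _
  (fun m => (1 + q ^+ (2 * m).+2) * (1 + q ^+ (2 * m).+3)) (fun=> 1)).
- apply: (mulrI (unit_qpochN 1)); rewrite mulrV ?unit_qpochN//.
  rewrite /alpha_sq /bailey_kernel (iqpochB0 p 0 0) (_ : 0 + 0 + 1 = 1)%N// (iqpoch0 p)
    -[LHS](iqpoch0 p) (iqS 0%N).
  by rewrite /qpoch big_ord1 /p /=; ring.
- by move=> m; rewrite unitrM !unit1q.
- move=> m; rewrite mul1r mulnS !addSn add0n.
  by rewrite -(qpochNSV (2 * m).+1) -(qpochNSV (2 * m).+2); ring.
move=> m; pose n := m.+1.
pose e r := (-1) ^+ r * q ^+ (r * r.-1) * (iqpochB p n r * iqpoch p (m + r)).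
pose V r := if r is r'.+1 then q ^+ (2 * r').+1 * theta_sq r' else -1.
pose W r := (1 - p ^+ n) * p ^+ n * q ^+ (r * r.-1) * (1 + p ^+ r) *
  (iqpochB p n r * iqpoch p (n + r)) * V r
            + 2 * p ^+ n * e r.
apply: (@telescope_pair _ _ 1 alpha_sq W m (1 - p ^+ n)).
- exact: uq.
- rewrite /W /e /= /iqpochB /= !subn0 !addn0 !expr0 (iqS m); ring.
- by rewrite /W /e !iqpochB_lt; (lia || ring).
move=> r k E; rewrite /alpha_sq /W /e -/n.
have -> : theta_sq r = V r + 2 * (-1) ^+ r by case: {E} r => [|r] //=; rewrite ?expr0; ring.
have -> : V r.+1 = q ^+ (2 * r).+1 * (V r + 2 * (-1) ^+ r).
  by case: {E} r => [|r] /=; rewrite ?expr0; ring.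
rewrite /n E iqpochB0 (iqpochB1 uq) /bailey_kernel iqpochB0 (iqpochB_pred uq E).
have -> : (r + k + r.+1 = (r + k + r).+1)%N by lia.
have -> : (r + k + r + 1 = (r + k + r).+1)%N by lia.
have -> : (m + r + 1 = r + k + r)%N by lia.
have -> : (m + r.+1 = r + k + r)%N by lia.
rewrite (iqS (m + r)%N) (_ : (m + r).+1 = r + k + r)%N; last by lia.
rewrite (iqS (r + k + r)%N).
rewrite (_ : (2 * m).+2 = (r + k) + (r + k))%N; last by lia.
rewrite (_ : r * r.+1 = r * r.-1 + r + r)%N; last by (case: {E} r => //= r; nia).
rewrite (_ : r.+1 * r.+1.-1 = r * r.-1 + r + r)%N; last by (case: {E} r => //= r; nia).
rewrite (_ : 2 * r = r + r)%N; last by lia.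
move: (V r) (iqpoch p _) (iqpoch p _) => v i j.
rewrite /p -!exprM !(exprS, exprD, mulSn, mul0n, addn0).
set y := q ^+ r; set z := q ^+ k; set B := q ^+ (r * r.-1).
ring.
Qed.

(** -q^((r+1)^2) times the sum of (-1)^j q^(-j^2) over -r-1 <= j <= r. *)
Fixpoint theta_sq1 r : R := if r is r'.+1 then
   q ^+ (2 * r).+1 * theta_sq1 r' + (-1) ^+ r * (1 - q ^+ (2 * r).+1) else 1 - q.

Definition alpha_sq1 r := q ^+ (r * r.+1) * (1 - q ^+ (r.+1 + r.+1)) * theta_sq1 r.

(** Again the new terms of [theta_sq1 r] form an alternating q-binomial sum; here
    the sequence e that sums them vanishes at r = 0. *)
Lemma pair_sq1 : bailey_pair p 2 alpha_sq1 (fun m => (qpoch (- q) q (2 * m).+2)^-1).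
Proof.
have iqS := iqpochS uq.
apply: (@bailey_pair_ind _ _ _ _ _
  (fun m => (1 + q ^+ (2 * m).+3) * (1 + q ^+ (2 * m).+4)) (fun=> 1)).
- apply: (mulrI (unit_qpochN 2)); rewrite mulrV ?unit_qpochN//.
  rewrite /alpha_sq1 /bailey_kernel (iqpochB0 p 0 0) (_ : 0 + 0 + 2 = 2)%N// (iqpoch0 p)
    -[LHS](iqpoch0 p) (iqS 0%N) (iqS 1%N).
  by rewrite /qpoch big_ord_recl big_ord1 /p /=; ring.
- by move=> m; rewrite unitrM !unit1q.
- move=> m; rewrite mul1r mulnS !addSn add0n.
  by rewrite -(qpochNSV (2 * m).+2) -(qpochNSV (2 * m).+3); ring.
move=> m; pose n := m.+1.
pose e r := (-1) ^+ r * q ^+ (r * r.-1) * (1 - p ^+ r) * (iqpochB p n r * iqpoch p (n + r)).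
pose V r := if r is r'.+1 then q ^+ (2 * r).+1 * theta_sq1 r' else 0.
pose W r := p ^+ n * e r + (1 - p ^+ n) * p ^+ n * q ^+ (r * r.-1) * (1 + q ^+ (2 * r).+1) *
  (iqpochB p n r * iqpoch p (n + r).+1) * V r.
apply: (@telescope_pair _ _ 2 alpha_sq1 W m (1 - p ^+ n)).
- exact: uq.
- rewrite /W /e /= expr0; ring.
- by rewrite /W /e !iqpochB_lt; (lia || ring).
move=> r k E; rewrite /alpha_sq1 /W /e -/n.
have -> : theta_sq1 r = V r + (-1) ^+ r * (1 - q ^+ (2 * r).+1).
  by case: {E} r => [|r] //=; rewrite ?expr0 ?expr1; ring.
have -> : V r.+1 = q ^+ (2 * r).+3 * (V r + (-1) ^+ r * (1 - q ^+ (2 * r).+1)).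
  by case: {E} r => [|r] /=; rewrite ?expr0 ?expr1 ?mulnS ?addSn ?add0n; ring.
rewrite /n E iqpochB0 (iqpochB1 uq) /bailey_kernel iqpochB0 (iqpochB_pred uq E).
have -> : (r + k + r.+1 = (r + k + r).+1)%N by lia.
have -> : (r + k + r + 2 = (r + k + r).+2)%N by lia.
have -> : (m + r + 2 = (r + k + r).+1)%N by lia.
rewrite (iqS (r + k + r)%N) (iqS (r + k + r).+1).
rewrite (_ : (2 * m).+3 = ((r + k) + (r + k)).+1)%N; last by lia.
rewrite (_ : r * r.+1 = r * r.-1 + r + r)%N; last by (case: {E} r => //= r; nia).
rewrite (_ : r.+1 * r.+1.-1 = r * r.-1 + r + r)%N; last by (case: {E} r => //= r; nia).
rewrite (_ : 2 * r.+1 = (r + r).+2)%N; last by lia.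
rewrite (_ : 2 * r = r + r)%N; last by lia.
move: (V r) (iqpoch p _) (iqpoch p _) => v i j.
rewrite /p -!exprM !(exprS, exprD, mulSn, mul0n, addn0).
set y := q ^+ r; set z := q ^+ k; set B := q ^+ (r * r.-1).
ring.
Qed.
End BaseSquare.

(** * The eight series after Bailey's transform *)

Section Terms.
Variables (R : comUnitRingType) (q : R).
Local Notation Q := (q ^+ 2).
Hypothesis uq : forall k, 1 - q ^+ k.+1 \is a GRing.unit.

Let uQ k : 1 - Q ^+ k.+1 \is a GRing.unit.
Proof. by rewrite -exprM mulnC muln2 doubleS. Qed.

Let u1q k : 1 + q ^+ k.+1 \is a GRing.unit := unit1q uQ k.

Let uP k : qpoch q q k \is a GRing.unit := unit_qpoch uq k.
Let uPQ k : qpoch Q Q k \is a GRing.unit := unit_qpoch uQ k.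
Let uN k : qpoch (- q) q k \is a GRing.unit := unit_qpochN uQ k.

Let uO k : qpoch q Q k \is a GRing.unit.
Proof.
elim: k => [|k H]; first by rewrite /qpoch big_ord0 unitr1.
by rewrite qpochS unitrM H -exprM -exprS uq.
Qed.

Lemma bin2E n : ('C(n.+1, 2) * 2 = n * n.+1)%N.
Proof. by elim: n => // n IH; rewrite binS bin1; lia. Qed.

Lemma half_bin2 n : ((n ^ 2 + n) %/ 2 = 'C(n.+1, 2))%N.
Proof. by rewrite -[RHS](@mulnK _ 2)// bin2E; congr (_ %/ _)%N; lia. Qed.

Lemma qpoch0 (p : R) n : qpoch 0 p n = 1.
Proof. by rewrite /qpoch big1// => i _; rewrite mul0r subr0. Qed.

Lemma hpoch0 (p : R) s n : hpoch p s 0 n = (-1) ^+ n * p ^+ (s * n + 'C(n, 2)).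
Proof.
elim: n => [|n IH]; first by rewrite /hpoch big_ord0 muln0 expr0 mulr1.
rewrite hpochS IH binS bin1 mulnS exprS !exprD; ring.
Qed.

Lemma qpoch_cat (a x : R) m n : qpoch a x (m + n) = qpoch a x m * qpoch (a * x ^+ m) x n.
Proof.
elim: n => [|n IH]; first by rewrite addn0 /qpoch big_ord0 mulr1.
by rewrite addnS !qpochS IH exprD; ring.
Qed.

Lemma qpoch_sqr n : qpoch Q Q n = qpoch q q n * qpoch (- q) q n.
Proof.
elim: n => [|n IH]; first by rewrite /qpoch !big_ord0 mulr1.
by rewrite !qpochS IH -exprM mul2n -addnn exprD; ring.
Qed.

Lemma qpoch_oe n : qpoch q q (2 * n) = qpoch q Q n * qpoch Q Q n.
Proof.
elim: n => [|n IH]; first by rewrite /qpoch !big_ord0 mulr1.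
by rewrite mulnS !addSn add0n !qpochS IH [q ^+ (2 * n).+1]exprS exprM; ring.
Qed.

Lemma antidiag_sqr r : antidiag Q 1 r = antidiag q 2 r.
Proof. by apply: eq_bigr => i _; rewrite -exprM mul1n mulnA. Qed.

Lemma hpoch_q1 r : hpoch Q 1 q r = q ^+ r * qpoch q Q r.
Proof.
elim: r => [|r IH]; first by rewrite /hpoch /qpoch !big_ord0 mulr1.
by rewrite hpochS IH qpochS add1n !exprS; ring.
Qed.

Lemma hpoch_q2 r : (1 - q) * hpoch Q 2 q r = q ^+ r * qpoch q Q r.+1.
Proof.
elim: r => [|r IH]; first by rewrite /hpoch /qpoch big_ord0 big_ord1 !expr0 mulr1 mul1r mulr1.
by rewrite hpochS mulrA IH [qpoch _ _ r.+2]qpochS !addSn !exprS; ring.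
Qed.

Lemma hpoch_Nq2 r : hpoch q 2 (- q) r = (-1) ^+ r * q ^+ r * qpoch (- q) q r.
Proof.
elim: r => [|r IH]; first by rewrite /hpoch /qpoch !big_ord0 !mulr1.
by rewrite hpochS IH qpochS !addSn !exprS; ring.
Qed.

(** The lemmas [summand_f1] to [summand_f8] put the summands into the form
    required by Bailey's transform; the series that start at 1 are shifted by
    one.  The pairs used have base q for f1, f2, f5, f6 and base q^2 for the
    others, with u = 0 in f1, f2, f5, f7, u = q in f3, f4, f8 and u = -q in
    f6. *)
Lemma summand_f1 n : q ^+ ((n ^ 2 + n) %/ 2) * qpoch q q (2 * n)
    / (qpoch (- q) q n * qpoch q q (2 * n + 1)) =
  1 * (qpoch q q n * hpoch q 1 0 n * beta_mix2 q n).
Proof.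
rewrite half_bin2 addn1 [qpoch q q (2 * n).+1]qpochS hpoch0 /beta_mix2 qpoch_sqr mul1n binS bin1
  -exprS.
rewrite (addnC n) !invrM ?unitrM ?uP ?uN ?uq//.
rewrite [LHS](_ : _ = q ^+ ('C(n, 2) + n) * (qpoch (- q) q n)^-1 * (1 - q ^+ (2 * n).+1)^-1 *
  (qpoch q q (2 * n) / qpoch q q (2 * n))); last by ring.
rewrite [RHS](_ : _ = q ^+ ('C(n, 2) + n) * (qpoch (- q) q n)^-1 * (1 - q ^+ (2 * n).+1)^-1 *
  (qpoch q q n / qpoch q q n) * ((-1) ^+ n * (-1) ^+ n)); last by ring.
by rewrite !mulrV// -expr2 sqrr_sign !mulr1.
Qed.

Lemma summand_f2 n : q ^+ (((1 + n) ^ 2 + (1 + n)) %/ 2) * qpoch q q (2 * (1 + n) - 2)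
  / (qpoch (- q) q (1 + n - 1) * qpoch q q (2 * (1 + n) - 1)) =
  q * (qpoch q q n * hpoch q 2 0 n * beta_mix2 q n).
Proof.
have := summand_f1 n; rewrite mul1r half_bin2 add1n half_bin2 addn1 subn1 mulnS subn1 addKn /=.
rewrite (binS n.+1) bin1 addnC exprD -!mulrA => ->.
by rewrite !hpoch0 (mulSn 1 n) -addnA [q ^+ (n + _)]exprD [q ^+ n.+1]exprS; ring.
Qed.

Lemma summand_f3 n : qpoch q q (2 * n) / qpoch (- q) q (2 * n + 1) * q ^+ n =
  1 * (qpoch Q Q n * hpoch Q 1 q n * (qpoch (- q) q (2 * n).+1)^-1).
Proof. by rewrite hpoch_q1 qpoch_oe addn1; ring. Qed.

Lemma summand_f4 n : qpoch q q (2 * n + 1) / qpoch (- q) q (2 * n + 2) * q ^+ (n + 1) =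
  q * (1 - q) * (qpoch Q Q n * hpoch Q 2 q n * (qpoch (- q) q (2 * n).+2)^-1).
Proof.
rewrite addn2 !addn1 [qpoch q q _]qpochS qpoch_oe.
rewrite [RHS](_ : _ = q * ((1 - q) * hpoch Q 2 q n) * qpoch Q Q n / qpoch (- q) q (2 * n).+2);
  last by ring.
by rewrite hpoch_q2 [qpoch q Q n.+1]qpochS [q ^+ (2 * n)]exprM [q ^+ n.+1]exprS; ring.
Qed.

Lemma summand_f5 n :
  (-1) ^+ n * (qpoch q q n / qpoch q Q (n + 1)) * q ^+ ((n ^ 2 + n) %/ 2) =
  1 * (qpoch q q n * hpoch q 1 0 n * (qpoch q Q n.+1)^-1).
Proof. by rewrite half_bin2 hpoch0 mul1n binS bin1 addn1 addnC; ring. Qed.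

Lemma summand_f6 n : (-1) ^+ (1 + n) * (qpoch q q (1 + n - 1) * qpoch Q Q (1 + n - 1)
    / qpoch q q (2 * (1 + n) - 1)) * q ^+ (1 + n) =
  (- q) * (qpoch q q n * hpoch q 2 (- q) n * (qpoch q q n / qpoch q q (2 * n).+1)).
Proof.
rewrite add1n subn1 mulnS subn1 /= hpoch_Nq2 qpoch_sqr !exprS; ring.
Qed.

Lemma summand_f7 n : (-1) ^+ n * (q ^+ (n ^ 2 + n) * qpoch Q Q n / qpoch (- q) q (2 * n + 1)) =
  1 * (qpoch Q Q n * hpoch Q 1 0 n * (qpoch (- q) q (2 * n).+1)^-1).
Proof.
rewrite hpoch0 mul1n addn1 -exprM (_ : 2 * (n + _) = n ^ 2 + n)%N; first by ring.
have := bin2E n; rewrite binS bin1; lia.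
Qed.

Lemma summand_f8 n :
  qpoch q q (2 * (1 + n) - 1) / qpoch (q ^+ (2 * (1 + n))) Q (1 + n) * q ^+ (1 + n) =
  q * (1 - q) * (qpoch Q Q n * hpoch Q 2 q n * (qpoch Q Q n / qpoch Q Q (2 * n).+1)).
Proof.
rewrite add1n (_ : (2 * n).+1 = n + n.+1)%N; last by lia.
rewrite qpoch_cat -exprS -exprM.
have un : qpoch (q ^+ (2 * n.+1)) Q n.+1 \is a GRing.unit.
  by have := uPQ (n + n.+1); rewrite qpoch_cat -exprS -exprM unitrM => /andP[].
rewrite invrM//.
rewrite [RHS](_ : _ = q * ((1 - q) * hpoch Q 2 q n) * qpoch Q Q n / qpoch (q ^+ (2 * n.+1)) Q n.+1 *
  (qpoch Q Q n / qpoch Q Q n)); last by ring.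
rewrite mulrV// hpoch_q2 [qpoch q Q n.+1]qpochS (_ : 2 * n.+1 - 1 = (2 * n).+1)%N; last by lia.
by rewrite [qpoch q q _]qpochS qpoch_oe [q ^+ (2 * n)]exprM [q ^+ n.+1]exprS; ring.
Qed.

(** For the values of u that occur, the q-Gauss sums are a monomial divided by
    at most two factors, which cancel in the following lemmas against factors of
    the pair. *)
Lemma bailey_gamma0 (p : R) r : (forall k, 1 - p ^+ k.+1 \is a GRing.unit) ->
  bailey_gamma p 0 0 r = (-1) ^+ r * p ^+ 'C(r.+1, 2).
Proof.
move=> up; rewrite /bailey_gamma addn0 qpoch0 invr1 mulr1 hpoch0 mul1n mulrAC binS bin1 addnC.
by rewrite mulrV ?unit_qpoch// mul1r.
Qed.

Lemma bailey_gamma1 (p u : R) r : (forall k, 1 - p ^+ k.+1 \is a GRing.unit) ->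
  (1 - p ^+ r.+1) * bailey_gamma p u 1 r = hpoch p 2 u r / qpoch u p r.+1.
Proof.
move=> up; rewrite /bailey_gamma addn1 [LHS](_ : _ = hpoch p 2 u r / qpoch u p r.+1 * (qpoch p p r *
  (iqpoch p r.+1 * (1 - p ^+ r.+1)))); last by ring.
by rewrite -iqpochS// mulrV ?unit_qpoch// mulr1.
Qed.

Lemma bailey_gamma_q r : (1 - q ^+ (2 * r).+1) * bailey_gamma Q q 0 r = q ^+ r.
Proof.
have u1 : 1 - q ^+ (2 * r).+1 \is a GRing.unit by exact: uq.
rewrite /bailey_gamma addn0 hpoch_q1 qpochS -exprM -exprS invrM ?uO//.
rewrite [LHS](_ : _ = q ^+ r * (qpoch Q Q r * iqpoch Q r) * (qpoch q Q r / qpoch q Q r) *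
  ((1 - q ^+ (2 * r).+1) / (1 - q ^+ (2 * r).+1))); last by ring.
by rewrite !mulrV// !mulr1.
Qed.

Lemma bailey_gamma_q1 r : (1 - q) * (1 - q ^+ (r.+1 + r.+1)) * bailey_gamma Q q 1 r = q ^+ r.
Proof.
rewrite addnn -mul2n exprM -mulrA bailey_gamma1// mulrA hpoch_q2.
by rewrite mulrK.
Qed.

Lemma bailey_gamma_Nq r : (1 - q ^+ (r.+1 + r.+1)) * bailey_gamma q (- q) 1 r = (-1) ^+ r * q ^+ r.
Proof.
rewrite [X in X * _](_ : _ = (1 + q ^+ r.+1) * (1 - q ^+ r.+1)); last by rewrite exprD; ring.
rewrite -mulrA bailey_gamma1// hpoch_Nq2 qpochS invrM// mulNr opprK -?exprS//.
rewrite [LHS](_ : _ = (-1) ^+ r * q ^+ r * (qpoch (- q) q r / qpoch (- q) q r) *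
  ((1 + q ^+ r.+1) / (1 + q ^+ r.+1))); last by ring.
by rewrite !mulrV// !mulr1.
Qed.

(** The lemmas [hecke_f1] to [hecke_f8] give the summands of the eight series
    after the transform: monomials times finite theta sums. *)
Lemma hecke_f1 r : 1 * (((-1) ^+ r * antidiag q 2 r -
    (if r is r'.+1 then q ^+ (r + r) * ((-1) ^+ r' * antidiag q 2 r') else 0)) *
    bailey_gamma q 0 0 r) =
  q ^+ 'C(r.+1, 2) * (antidiag q 2 r + (if r is r'.+1 then q ^+ (r + r) * antidiag q 2 r' else 0)).
Proof.
rewrite bailey_gamma0//; have E : (-1) ^+ r * (-1) ^+ r = 1 :> R by rewrite -expr2 sqrr_sign.
rewrite [LHS](_ : _ = ((-1) ^+ r * (-1) ^+ r) * (q ^+ 'C(r.+1, 2) *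
  (antidiag q 2 r + (if r is r'.+1 then q ^+ (r + r) * antidiag q 2 r' else 0))));
    first by rewrite E mul1r.
by case: {E} r => [|r] /=; rewrite ?[(-1) ^+ r.+1]exprS; ring.
Qed.

Lemma hecke_f2 r : q * (alpha_mix2 q r * bailey_gamma q 0 1 r) =
  q ^+ (r + 'C(r.+1, 2)).+1 * antidiag q 2 r + q ^+ ((r + 'C(r.+1, 2)).+1 + r.+1) * antidiag q 2 r.
Proof.
have E : (-1) ^+ r * (-1) ^+ r = 1 :> R by rewrite -expr2 sqrr_sign.
rewrite /alpha_mix2 [LHS](_ : _ = q * (-1) ^+ r * antidiag q 2 r * (1 + q ^+ r.+1) *
  ((1 - q ^+ r.+1) * bailey_gamma q 0 1 r)); last by rewrite exprD; ring.
rewrite bailey_gamma1// hpoch0 qpoch0 invr1 mulr1 (_ : 2 * r + _ = r + 'C(r.+1, 2))%N; last first.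
  by rewrite binS bin1; lia.
rewrite [LHS](_ : _ = ((-1) ^+ r * (-1) ^+ r) *
  (q * q ^+ (r + 'C(r.+1, 2)) * antidiag q 2 r * (1 + q ^+ r.+1))); last by ring.
by rewrite E [q ^+ (_ + r.+1)]exprD [q ^+ (_ + _).+1]exprS; ring.
Qed.

Lemma hecke_f3 r : 1 * (alpha_sq q r * bailey_gamma Q q 0 r) = q ^+ (r * r.+1 + r) * theta_sq q r.
Proof.
rewrite /alpha_sq [LHS](_ : _ =
  q ^+ (r * r.+1) * theta_sq q r * ((1 - q ^+ (2 * r).+1) * bailey_gamma Q q 0 r)); last by ring.
by rewrite bailey_gamma_q exprD; ring.
Qed.

Lemma hecke_f4 r : q * (1 - q) * (alpha_sq1 q r * bailey_gamma Q q 1 r) =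
  q ^+ (r * r.+1 + r.+1) * theta_sq1 q r.
Proof.
rewrite /alpha_sq1 [LHS](_ : _ =
  q * q ^+ (r * r.+1) * theta_sq1 q r *
  ((1 - q) * (1 - q ^+ (r.+1 + r.+1)) * bailey_gamma Q q 1 r)); last by ring.
by rewrite bailey_gamma_q1 exprD [q ^+ r.+1]exprS; ring.
Qed.

Lemma hecke_f5 r : 1 * (alpha_tri q r * bailey_gamma q 0 0 r) =
  q ^+ (r + 'C(r.+1, 2)) * theta_tri q r.
Proof.
rewrite bailey_gamma0// /alpha_tri;
  have E : (-1) ^+ r * (-1) ^+ r = 1 :> R by rewrite -expr2 sqrr_sign.
rewrite exprD [LHS](_ : _ = ((-1) ^+ r * (-1) ^+ r) *
  (q ^+ r * q ^+ 'C(r.+1, 2) * theta_tri q r)); last by ring.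
by rewrite E mul1r.
Qed.

Lemma hecke_f6 r : - q * (alpha_mix1 q r * bailey_gamma q (- q) 1 r) =
  - (q ^+ (r.+1 + 'C(r.+1, 2)) * antidiag q 1 r).
Proof.
have E : (-1) ^+ r * (-1) ^+ r = 1 :> R by rewrite -expr2 sqrr_sign.
rewrite /alpha_mix1 [LHS](_ : _ =
  - ((-1) ^+ r * q * q ^+ 'C(r.+1, 2) * antidiag q 1 r *
  ((1 - q ^+ (r.+1 + r.+1)) * bailey_gamma q (- q) 1 r))); last by ring.
rewrite bailey_gamma_Nq exprD [q ^+ r.+1]exprS.
rewrite [LHS](_ : _ = - (((-1) ^+ r * (-1) ^+ r) *
  (q * q ^+ r * q ^+ 'C(r.+1, 2) * antidiag q 1 r))); last by ring.
by rewrite E mul1r.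
Qed.

Lemma hecke_f7 r : 1 * (alpha_sq q r * bailey_gamma Q 0 0 r) =
  (-1) ^+ r * (q ^+ (r * r.+1 + r * r.+1) * theta_sq q r
    - q ^+ (r * r.+1 + r * r.+1 + (2 * r).+1) * theta_sq q r).
Proof.
rewrite bailey_gamma0// /alpha_sq -exprM (mulnC 2 'C(_,_))
  bin2E [q ^+ (_ + (2 * r).+1)]exprD exprD; ring.
Qed.

Lemma hecke_f8 r : q * (1 - q) * (alpha_mix1 Q r * bailey_gamma Q q 1 r) =
  (-1) ^+ r * (q ^+ (r * r.+1 + r.+1) * antidiag q 2 r
    + q ^+ (r * r.+1 + r.+1 + (r.+1 + r.+1)) * antidiag q 2 r).
Proof.
rewrite /alpha_mix1 antidiag_sqr -!exprM (mulnC 2 'C(_,_)) bin2E.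
rewrite [LHS](_ : _ = (-1) ^+ r * q * q ^+ (r * r.+1) * antidiag q 2 r * (1 + q ^+ (r.+1 + r.+1)) *
   ((1 - q) * (1 - q ^+ (r.+1 + r.+1)) * bailey_gamma Q q 1 r)); last first.
  by rewrite mul2n -addnn [q ^+ (_ + (r.+1 + r.+1))]exprD; ring.
by rewrite bailey_gamma_q1 [q ^+ (r * r.+1 + r.+1 + _)]exprD [q ^+ (r * r.+1 + r.+1)]exprD
  [q ^+ r.+1]exprS; ring.
Qed.
End Terms.

(** * Supports of power series *)

Section Support.
Variable R : comNzRingType.
Implicit Types (f g : fps R) (E : nat -> Prop).

Definition supp E f := forall k, coef f k != 0 -> E k.

Lemma supp0 E : supp E 0.
Proof. by move=> k; rewrite coef0 eqxx. Qed.

Lemma suppD E f g : supp E f -> supp E g -> supp E (f + g).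
Proof.
move=> Ef Eg k; rewrite coefD.
have [->|/Ef//] := eqVneq (coef f k) 0; rewrite add0r; exact: Eg.
Qed.

Lemma suppN E f : supp E f -> supp E (- f).
Proof. by move=> Ef k; rewrite coefN oppr_eq0; exact: Ef. Qed.

Lemma supp_signM E f r : supp E f -> supp E ((-1) ^+ r * f).
Proof.
by rewrite -signr_odd; case: odd; rewrite ?mul1r// expr1 mulN1r => /suppN.
Qed.

Lemma supp_sum E (I : Type) (r : seq I) (P : pred I) (F : I -> fps R) :
  (forall i, P i -> supp E (F i)) -> supp E (\sum_(i <- r | P i) F i).
Proof. by move=> EF; apply: big_ind => //; [exact: supp0|exact: suppD]. Qed.

Lemma supp_XM E a f : supp (fun k => E (a + k)%N) f -> supp E (fps_X R ^+ a * f).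
Proof.
move=> Ef k; rewrite coef_fps_XnM; case: ltnP => [_|ak]; first by rewrite eqxx.
by move/Ef; rewrite subnKC.
Qed.

Lemma supp_1 E : E 0%N -> supp E 1.
Proof. by move=> E0 [|k]//; rewrite coef1 eqxx. Qed.

Lemma supp_X E a : E a -> supp E (fps_X R ^+ a).
Proof.
by move=> Ea; rewrite -[_ ^+ _]mulr1; apply: supp_XM; apply: supp_1; rewrite addn0.
Qed.

Definition Xdvd a f := supp (leq a) f.

Lemma XdvdM a b f g : Xdvd a f -> Xdvd b g -> Xdvd (a + b) (f * g).
Proof.
move=> af bg k; rewrite leqNgt; apply: contra => kab.
rewrite coefM big1// => -[i /= ik] _; have [ai|ia] := leqP a i; last first.
  by have [->|/af] := eqVneq (coef f i) 0; rewrite ?mul0r// leqNgt ia.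
have [->|/bg] := eqVneq (coef g (k - i)) 0; rewrite ?mulr0//.
lia.
Qed.

Lemma Xdvd0 f : Xdvd 0 f.
Proof. by []. Qed.

Lemma Xdvd1 f : coef f 0 = 0 -> Xdvd 1 f.
Proof. by move=> f0 [|k]//; rewrite f0 eqxx. Qed.

End Support.

Section Hecke.
Variables (p u : fps int).
Hypotheses (p0 : coef p 0 = 0) (u0 : coef u 0 = 0).

Lemma unit_1B (x : fps int) : coef x 0 = 0 -> 1 - x \is a GRing.unit.
Proof. by move=> x0; rewrite unit_fpsE coefD coefN x0 subr0. Qed.

Lemma coef_expS0 (x : fps int) k : coef x 0 = 0 -> coef (x ^+ k.+1) 0 = 0.
Proof. by move=> x0; rewrite exprS coefM0 x0 mul0r. Qed.

Lemma unit_1BX k : 1 - p ^+ k.+1 \is a GRing.unit.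
Proof. by apply/unit_1B/coef_expS0. Qed.

Lemma Xdvd_hpoch s m : Xdvd m (hpoch p s.+1 u m).
Proof.
elim: m => [|m IH]; first exact: Xdvd0.
rewrite hpochS -addn1; apply: XdvdM => //; apply: Xdvd1.
by rewrite coefD coefN u0 addSn coef_expS0// subr0.
Qed.

(** Modulo q^(k+1) both sums are finite, and the remainder of the transform is
    divisible by q^(k+1). *)
Lemma coef_bailey s (a b t h : nat -> fps int) (c : fps int) s0 k :
    bailey_pair p s.+1 a b -> Xdvd s0 c ->
    (forall m, t (s0 + m)%N = c * (qpoch p p m * hpoch p s.+1 u m * b m)) ->
    (forall r, c * (a r * bailey_gamma p u s r) = h r) ->
  coef (fps_sum s0 t) k = \sum_(r < k.+1) coef (h r) k.
Proof.
move=> ab cs tE hE.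
rewrite (@coef_fps_sum _ _ _ _ (s0 + k.+1)); last by rewrite addnS ltnS leq_addl.
  rewrite -{1}[s0]add0n big_addn addKn big_mkord.
  rewrite -coef_sum.
  have -> : \sum_(i < k.+1) t (i + s0)%N =
     c * \sum_(m < k.+1) qpoch p p m * hpoch p s.+1 u m * b m.
    by rewrite mulr_sumr; apply: eq_bigr => i _; rewrite addnC tE.
  have uu j : 1 - u * p ^+ j \is a GRing.unit.
    by apply: unit_1B; rewrite coefM0 u0 mul0r.
  have [g ->] := bailey_transform unit_1BX k.+1 uu ab.
  rewrite mulrDr coefD [X in _ + X](_ : _ = 0).
    by rewrite addr0 mulr_sumr coef_sum; apply: eq_bigr => r _; rewrite hE.
  have /(_ k) : Xdvd (0 + (k.+1 + 0)) (c * (hpoch p s.+1 u k.+1 * g)).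
    apply: XdvdM; [exact: Xdvd0|apply: XdvdM; [exact: Xdvd_hpoch|exact: Xdvd0]].
  by case: eqVneq => // _ /(_ isT); rewrite add0n addn0 ltnn.
move=> n j sn jn; rewrite -(subnKC sn) tE.
have /(_ j) : Xdvd (s0 + (0 + (n - s0) + 0))
  (c * (qpoch p p (n - s0) * hpoch p s.+1 u (n - s0) * b (n - s0)%N)).
  apply: XdvdM => //; apply: XdvdM; last exact: Xdvd0.
  apply: XdvdM; [exact: Xdvd0|exact: Xdvd_hpoch].
by case: eqVneq => // _ /(_ isT); rewrite add0n addn0 subnKC// leqNgt jn.
Qed.

Lemma supp_bailey s (a b t h : nat -> fps int) (c : fps int) s0 (E : nat -> Prop) :
    bailey_pair p s.+1 a b -> Xdvd s0 c ->
    (forall m, t (s0 + m)%N = c * (qpoch p p m * hpoch p s.+1 u m * b m)) ->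
    (forall r, c * (a r * bailey_gamma p u s r) = h r) ->
    (forall r, supp E (h r)) ->
  supp E (fps_sum s0 t).
Proof.
move=> ab cs tE hE Eh k; rewrite (coef_bailey _ ab cs tE hE) -coef_sum.
by apply: supp_sum => r _; exact: Eh.
Qed.

End Hecke.

(** * The exponents are norms *)

(** The factor c makes it possible to diagonalise every form that occurs as
    x^2 - D y^2. *)
Definition norm_set (D : nat) (c A B : int) (n : nat) :=
  exists x y : int, x ^+ 2 - D%:Z * y ^+ 2 = c * (A * n%:Z + B).

Section Supports.
Local Notation q := (fps_X int).

Let q0 : coef q 0 = 0. Proof. by []. Qed.
Let qq0 : coef (q ^+ 2) 0 = 0. Proof. exact: coef_expS0. Qed.
Let c00 : coef (0 : fps int) 0 = 0. Proof. by []. Qed.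
Let Nq0 : coef (- q) 0 = 0. Proof. by rewrite coefN. Qed.
Let uq := unit_1BX q0.
Let uqq := unit_1BX qq0.

Lemma supp_XMantidiag E a c r : (forall i j, r = (i + j)%N -> E (a + c * i * j)%N) ->
  supp E (q ^+ a * antidiag q c r).
Proof.
move=> EE; apply: supp_XM; apply: supp_sum => -[i /= ir] _; apply: supp_X.
by apply: EE; rewrite subnKC.
Qed.

Lemma supp_theta_sq r : supp (fun e => exists j, e + j * j = r * r)%N (theta_sq q r).
Proof.
elim: r => [|r IH]; first by apply: supp_1; exists 0%N.
rewrite [theta_sq q _]/=; apply: suppD.
  by apply: supp_XM => k /IH [j E]; exists j; nia.
rewrite mulrC; apply: supp_signM; rewrite -[2]/(1 + 1).
by apply: suppD; apply: supp_1; exists r.+1.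
Qed.

Lemma supp_theta_tri r : supp (fun e => exists j, e + 'C(j.+1, 2) = r * r)%N (theta_tri q r).
Proof.
elim: r => [|r IH]; first by apply: supp_1; exists 0%N.
rewrite [theta_tri q _]/=; apply: suppD; first apply: suppD.
- by apply: supp_XM => k /IH [j E]; exists j; nia.
- by apply: supp_X; exists r; have := bin2E r; have := bin2E r.+1; nia.
- by apply: supp_X; exists r.+1; have := bin2E r; have := bin2E r.+1; nia.
Qed.

Lemma supp_theta_sq1 r : supp (fun e => exists j, e + j * j = r.+1 * r.+1)%N (theta_sq1 q r).
Proof.
elim: r => [|r IH].
  apply: suppD; first by apply: supp_1; exists 1%N.
  by apply: suppN; rewrite -[q]expr1; apply: supp_X; exists 0%N.
rewrite [theta_sq1 q _]/=; apply: suppD.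
  by apply: supp_XM => k /IH [j E]; exists j; nia.
apply: supp_signM; apply: suppD; first by apply: supp_1; exists r.+2.
by apply: suppN; apply: supp_X; exists r.+1; nia.
Qed.

(** In f1, f2, f6 and f8 the term q^(c i j) is made diagonal by
    4 i j = (i+j)^2 - (i-j)^2; the witnesses x, y then come from completing
    squares in i + j, or in r for the other series. *)
Lemma supp_f1 : supp (norm_set 2 1 16 1) f1.
Proof.
eapply (@supp_bailey q 0 q0 c00 0 _ _ _ _ 1 0 _ (pair_mix2_lower uq) (@Xdvd0 _ _));
  [exact: (summand_f1 uq)|exact: (hecke_f1 uq)|move=> r; cbv beta].
rewrite mulrDr; apply: suppD.
  apply: supp_XMantidiag => i j ->; exists (4 * (i%:Z + j%:Z) + 1), (2 * (i%:Z - j%:Z)).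
  by have := bin2E (i + j); nia.
case: r => [|r]; first by rewrite mulr0; exact: supp0.
rewrite mulrA -exprD.
apply: supp_XMantidiag => i j ->; exists (4 * (i%:Z + j%:Z) + 7), (2 * (i%:Z - j%:Z)).
by have := bin2E (i + j).+1; nia.
Qed.

Lemma supp_f2 : supp (norm_set 2 1 16 (-7)) f2.
Proof.
eapply (@supp_bailey q 0 q0 c00 1 _ _ _ _ q 1 _ (pair_mix2 uq) (Xdvd1 q0));
  [exact: (summand_f2 uq)|exact: (hecke_f2 uq)|move=> r; cbv beta].
apply: suppD; apply: supp_XMantidiag => i j ->.
  exists (4 * (i%:Z + j%:Z) + 3), (2 * (i%:Z - j%:Z)).
  by have := bin2E (i + j); nia.
exists (4 * (i%:Z + j%:Z) + 5), (2 * (i%:Z - j%:Z)).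
by have := bin2E (i + j); nia.
Qed.

Lemma supp_f3 : supp (norm_set 2 1 2 1) f3.
Proof.
eapply (@supp_bailey (q ^+ 2) q qq0 q0 0 _ _ _ _ 1 0 _ (pair_sq uqq) (@Xdvd0 _ _));
  [exact: (summand_f3 _)|exact: (hecke_f3 uq)|move=> r; cbv beta].
apply: supp_XM => k /supp_theta_sq [j E].
by exists (2 * r%:Z + 1), (j%:Z); nia.
Qed.

Let Xc : Xdvd 1 (q * (1 - q)).
Proof. by apply: Xdvd1; rewrite coefM0 q0 mul0r. Qed.

Lemma supp_f4 : supp (norm_set 2 (-1) 1 0) f4.
Proof.
eapply (@supp_bailey (q ^+ 2) q qq0 q0 1 _ _ _ _ (q * (1 - q)) 0 _ (pair_sq1 uqq) (@Xdvd0 _ _));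
  [exact: (summand_f4 _)|exact: (hecke_f4 uq)|move=> r; cbv beta].
apply: supp_XM => k /supp_theta_sq1 [j E].
by exists (j%:Z), (r%:Z + 1); nia.
Qed.

Lemma supp_f5 : supp (norm_set 3 (-2) 4 1) f5.
Proof.
eapply (@supp_bailey q 0 q0 c00 0 _ _ _ _ 1 0 _ (pair_tri uq) (@Xdvd0 _ _));
  [exact: (summand_f5 _)|exact: (hecke_f5 uq)|move=> r; cbv beta].
apply: supp_XM => k /supp_theta_tri [j E].
by exists (2 * j%:Z + 1), (2 * r%:Z + 1); have := bin2E r; have := bin2E j; nia.
Qed.

Lemma supp_f6 : supp (norm_set 3 (-1) 4 (-1)) f6.
Proof.
eapply (@supp_bailey q (- q) q0 Nq0 1 _ _ _ _ (- q) 1 _ (pair_mix1 uq) (Xdvd1 Nq0));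
  [exact: (summand_f6 _)|exact: (hecke_f6 uq)|move=> r; cbv beta].
apply: suppN; apply: supp_XMantidiag => i j ->.
by exists (i%:Z - j%:Z), (i%:Z + j%:Z + 1); have := bin2E (i + j); nia.
Qed.

Lemma supp_f7 : supp (norm_set 3 1 3 1) f7.
Proof.
eapply (@supp_bailey (q ^+ 2) 0 qq0 c00 0 _ _ _ _ 1 0 _ (pair_sq uqq) (@Xdvd0 _ _));
  [exact: (summand_f7 _)|exact: (hecke_f7 uq)|move=> r; cbv beta].
apply: supp_signM; apply: suppD; last apply: suppN.
  by apply: supp_XM => k /supp_theta_sq [j E]; exists (3 * r%:Z + 1), (j%:Z); nia.
by apply: supp_XM => k /supp_theta_sq [j E]; exists (3 * r%:Z + 2), (j%:Z); nia.
Qed.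

Lemma supp_f8 : supp (norm_set 3 2 3 (-1)) f8.
Proof.
eapply (@supp_bailey (q ^+ 2) q qq0 q0 1 _ _ _ _ (q * (1 - q)) 1 _ (pair_mix1 uqq) Xc);
  [exact: (summand_f8 uq)|exact: (hecke_f8 uq)|move=> r; cbv beta].
apply: supp_signM; apply: suppD; apply: supp_XMantidiag => i j ->.
  by exists (3 * (i%:Z + j%:Z) + 2), (i%:Z - j%:Z); nia.
by exists (3 * (i%:Z + j%:Z) + 4), (i%:Z - j%:Z); nia.
Qed.
End Supports.

(** * Inert primes *)

Lemma big_dvdn (V : nmodType) (F : nat -> V) (P : pred nat) d M : (0 < d)%N ->
  \sum_(0 <= n < d * M | (d %| n)%N && P n) F n =
  \sum_(0 <= e < M | P (d * e)%N) F (d * e)%N.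
Proof.
move=> d0; elim: M => [|M IH]; first by rewrite muln0 !big_geq.
rewrite mulnS addnC (big_cat_nat (n := (d * M)%N)) ?leq_addr//= IH.
rewrite [RHS]big_mkcond big_nat_recr//= -big_mkcond/=; congr (_ + _).
rewrite -{1}[(d * M)%N]add0n big_addn addKn.
rewrite big_mkcond big_ltn//= add0n dvdn_mulr//= big_nat big1 ?addr0//.
move=> i /andP[i0 id]; rewrite dvdn_addl ?dvdn_mulr// gtnNdvd//.
Qed.

(** Common to the characters modulo 8 and 12 of Q(sqrt 2) and Q(sqrt 3).  The
    bound on the partial sums gives, by summation by parts, the bound on the
    sums of chi(d)/d in [chi_harm]. *)
Record quad_char (chi : nat -> int) : Prop := QuadChar {
  quad_char1 : chi 1 = 1;
  quad_charM : forall m n, chi (m * n)%N = chi m * chi n;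
  quad_charV : forall n, [|| chi n == 1, chi n == 0 | chi n == -1];
  quad_char2 : chi 2 = 0;
  quad_char_prime0 : forall p, prime p -> chi p = 0 -> (p <= 3)%N;
  quad_char_sum : forall y, \sum_(0 <= d < y.+1) chi d <= 1
}.

Section Character.
Variable chi : nat -> int.
Hypothesis chiP : quad_char chi.

Let chi1 := quad_char1 chiP.
Let chiM := quad_charM chiP.
Let chiV := quad_charV chiP.

Let chi0 : chi 0 = 0.
Proof. by rewrite -(muln0 2) chiM (quad_char2 chiP) mul0r. Qed.

Lemma chi_mul_ind (P : int -> Prop) n : P 1 -> (forall a b, P a -> P b -> P (a * b)) ->
  (0 < n)%N -> (forall p, prime p -> (p %| n)%N -> P (chi p)) -> P (chi n).
Proof.
move=> P1 PM; have [m] := ubnP n; elim: m n => // m IH n nm n0 Pn.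
have [->|n1] := eqVneq n 1%N; first by rewrite chi1.
have pr : prime (pdiv n) by apply: pdiv_prime; rewrite ltn_neqAle eq_sym n1.
have dn := pdiv_dvd n; rewrite -(divnK dn) chiM; apply: PM; last exact: Pn.
apply: IH; last first.
- by move=> p pp pd; apply: Pn => //; apply: dvdn_trans pd (dvdn_div dn).
- by rewrite divn_gt0 ?pdiv_gt0// dvdn_leq.
by rewrite -ltnS; apply: leq_trans nm; rewrite ltnS ltn_Pdiv// prime_gt1.
Qed.

(** The Dirichlet convolution of 1 and chi: the number of ideals of norm n when
    chi is the character of a quadratic field. *)
Definition rep n : int := \sum_(0 <= d < n.+1 | (d %| n)%N) chi d.

Lemma rep_widen n N : (0 < n)%N -> (n < N)%N ->
  rep n = \sum_(0 <= d < N | (d %| n)%N) chi d.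
Proof.
move=> n0 nN; rewrite (big_cat_nat (n := n.+1))//= [X in _ + X]big_nat_cond.
rewrite [X in _ + X]big1 ?addr0// => d /andP[/andP[nd _]] /(dvdn_leq n0).
by rewrite leqNgt nd.
Qed.

(** Divisors of p n that are prime to p are the divisors of n that are prime to
    p, and a divisor p e contributes -chi e.  What does not cancel is the sum
    over divisors of n that are multiples of p. *)
Lemma rep_inert p n : prime p -> chi p = -1 -> (0 < n)%N ->
  rep (p * n) = \sum_(0 <= e < n.+1 | (p * e %| n)%N) chi e.
Proof.
move=> pp cp n0; have p0 := prime_gt0 pp.
have pn : (p * n < p * n.+1)%N by rewrite ltn_pmul2l.
have chip e : chi (p * e)%N = - chi e by rewrite chiM cp mulN1r.
have mult P : \sum_(0 <= d < p * n.+1 | P d && (p %| d)%N) chi d =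
    - \sum_(0 <= e < n.+1 | P (p * e)%N) chi e.
  rewrite (eq_bigl (fun d => (p %| d)%N && P d)) => [|d]; last by rewrite andbC.
  by rewrite (big_dvdn chi) // -sumrN; apply: eq_bigr => e _; exact: chip.
rewrite (rep_widen _ pn) ?muln_gt0 ?p0// (bigID (fun d => p %| d)%N)/= mult.
rewrite [X in - X + _](eq_bigl (fun d => d %| n)%N) => [|d]; last by rewrite dvdn_pmul2l.
rewrite -/(rep n) (rep_widen (N := (p * n.+1)%N) n0); last first.
  by apply: leq_trans pn; rewrite ltnS leq_pmull.
rewrite (bigID (fun d => p %| d)%N)/= mult opprD opprK -addrA; apply/eqP.
rewrite -subr_eq0 addrAC subrr add0r addrC subr_eq0; apply/eqP; apply: eq_bigl => d.
case: (boolP (p %| d)%N) => pd; rewrite ?andbF ?andbT//.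
by rewrite Gauss_dvdr// coprime_sym prime_coprime.
Qed.

(** By [rep_inert], an inert prime can be removed twice from n, or else rep
    vanishes; without inert prime factors all terms are nonnegative. *)
Lemma rep_ge0 n : 0 <= rep n.
Proof.
have [m] := ubnP n; elim: m n => // m IH n nm.
case: (posnP n) => [->|n0]; first by rewrite /rep big_mkcond big_nat1 /= chi0.
case: (boolP (has (fun p => chi p == -1) (primes n))) => [/hasP[p]|/hasPn ni].
  rewrite mem_primes => /and3P[pp _ /dvdnP[k E]] /eqP cp.
  have p1 := prime_gt1 pp; have p0 := prime_gt0 pp.
  have k0 : (0 < k)%N by case: k E n0 => // ->.
  rewrite E mulnC rep_inert//; have [/dvdnP[l El]|pk] := boolP (p %| k)%N.
    have l0 : (0 < l)%N by case: l El k0 => // ->.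
    rewrite El mulnC (eq_bigl (fun e => e %| l)%N) => [|e]; last by rewrite dvdn_pmul2l.
    rewrite -rep_widen// ?ltnS ?leq_pmull//; apply: IH; nia.
  rewrite big1// => e pek; case/negP: pk; exact: dvdn_trans (dvdn_mulr _ (dvdnn p)) pek.
rewrite /rep big_nat_cond; apply: sumr_ge0 => d /andP[_ dn].
have d0 : (0 < d)%N := dvdn_gt0 n0 dn.
apply: (@chi_mul_ind (fun x => 0 <= x)) => // [a b|p pp pd]; first exact: mulr_ge0.
have /ni : p \in primes n by rewrite mem_primes pp n0 (dvdn_trans pd).
by case/or3P: (chiV p) => /eqP ->.
Qed.

Definition harm y : rat := \sum_(0 <= n < y.+1) n%:R^-1.

Lemma harm_double n : 2^-1 <= harm (n.+1 + n.+1) - harm n.+1 <= 1.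
Proof.
have -> : harm (n.+1 + n.+1) - harm n.+1 = \sum_(n.+2 <= i < (n.+1 + n.+1).+1) i%:R^-1.
  rewrite /harm (big_cat_nat (n := n.+2) (p := (n.+1 + n.+1).+1))//=; last by lia.
  by rewrite addrAC subrr add0r.
have E (c : rat) : \sum_(n.+2 <= i < (n.+1 + n.+1).+1) c = c *+ n.+1.
  by rewrite sumr_const_nat; congr (_ *+ _); lia.
apply/andP; split.
  have -> : 2^-1 = (n.+1 + n.+1)%:R^-1 *+ n.+1 :> rat.
    rewrite -[RHS]mulr_natr natrD; set x := n.+1%:R : rat.
    have : x != 0 by rewrite pnatr_eq0.
    by move=> x0; rewrite -mulr2n -[x *+ 2]mulr_natl invfM mulfVK.
  rewrite -E big_nat_cond [leRHS]big_nat_cond; apply: ler_sum => i /andP[/andP[i1 i2] _].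
  by rewrite lef_pV2 ?posrE ?ltr0n ?ler_nat//; lia.
rewrite [leRHS](_ : 1 = n.+1%:R^-1 *+ n.+1 :> rat); last first.
  by rewrite -[RHS]mulr_natr mulVf// pnatr_eq0.
rewrite -[leRHS]E big_nat_cond [leRHS]big_nat_cond; apply: ler_sum => i /andP[/andP[i1 i2] _].
by rewrite lef_pV2 ?posrE ?ltr0n ?ler_nat//; lia.
Qed.

Lemma harm_bounds k : 1 + k%:R / 2 <= harm (2 ^ k) <= 1 + k%:R.
Proof.
elim: k => [|k /andP[IH1 IH2]].
  by rewrite expn0 /harm !big_nat_recl//= big_geq// !(invr0, mul0r, addr0, add0r, invr1) lexx.
have : (0 < 2 ^ k)%N by rewrite expn_gt0.
rewrite expnS mul2n -addnn; case: (2 ^ k)%N IH1 IH2 => // n IH1 IH2 _.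
have /andP[h1 h2] := harm_double n; rewrite -[k.+1]addn1 natrD.
by apply/andP; split; lra.
Qed.

(** Summation by parts against the partial sums of chi, which are at most 1. *)
Lemma chi_harm y : \sum_(0 <= d < y.+1) (chi d)%:~R / d%:R <= 1 :> rat.
Proof.
suff : \sum_(0 <= d < y.+1) (chi d)%:~R / d%:R <=
    1 + ((\sum_(0 <= d < y.+1) chi d)%:~R - 1) / y.+1%:R :> rat.
  move=> /le_trans; apply; rewrite gerDl; apply: mulr_le0_ge0; last by rewrite invr_ge0 ler0n.
  by rewrite subr_le0 -[1]/(1%:~R) ler_int (quad_char_sum chiP).
elim: y => [|y IH]; first by rewrite !big_nat1 chi0 mul0r invr1 mulr1 addrC subrK.
rewrite big_nat_recr//= [X in _ <= 1 + (X%:~R - 1) / _]big_nat_recr//= intrD.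
have S1 := quad_char_sum chiP y.+1; rewrite big_nat_recr//= in S1.
move: IH S1; set A := \sum_(0 <= d < y.+1) _; set B := \sum_(0 <= d < y.+1) _ => IH S1.
have S2 : B%:~R + (chi y.+1)%:~R <= 1 :> rat by rewrite -intrD -[1]/(1%:~R) ler_int.
have H : (B%:~R + (chi y.+1)%:~R - 1) / y.+1%:R <= (B%:~R + (chi y.+1)%:~R - 1) / y.+2%:R :> rat.
  rewrite ler_wnM2l ?subr_le0// lef_pV2 ?posrE ?ltr0n ?ler_nat//.
move: H IH; rewrite !mulrBl !mulrDl.
by move: (B%:~R) ((chi y.+1)%:~R) (y.+1%:R^-1) (y.+2%:R^-1) => b c u v; lra.
Qed.

(** Writing n = d e exchanges a divisor sum with a sum over pairs (d, e). *)
Lemma sum_dvdn (c g : nat -> rat) N : c 0%N = 0 ->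
  \sum_(0 <= n < N.+1) g n * (\sum_(0 <= d < N.+1 | (d %| n)%N) c d) =
  \sum_(0 <= d < N.+1) c d * (\sum_(0 <= e < N.+1 | (d * e <= N)%N) g (d * e)%N).
Proof.
move=> c0; under eq_bigr do rewrite mulr_sumr big_mkcond/=.
rewrite exchange_big/=; apply: eq_bigr => d _.
case: (posnP d) => [->|d0]; first by rewrite c0 mul0r big1// => n _; rewrite mulr0 if_same.
rewrite -big_mkcond/= mulr_sumr.
rewrite -(big_dvdn (fun n => c d * g n) (fun n => n <= N)%N N.+1 d0).
rewrite (big_cat_nat (n := N.+1) (p := (d * N.+1)%N))//=; last by rewrite leq_pmull.
rewrite [X in _ = _ + X]big_nat_cond [X in _ = _ + X]big1 ?addr0 => [|n]; last first.
  by rewrite ltnNge => /andP[/andP[/negPf-> _]]; rewrite andbF.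
rewrite big_nat_cond [RHS]big_nat_cond.
by apply: eq_big => [n|n _]; [rewrite !leq0n /= ltnS; case: leqP;
  rewrite ?andbT ?andbF|rewrite mulrC].
Qed.

(** Grouping by the cofactor e of d in n leaves the sums of [chi_harm], with
    weights 1/e. *)
Lemma rep_sum N : \sum_(0 <= n < N.+1) (rep n)%:~R / n%:R <= harm N :> rat.
Proof.
have -> : \sum_(0 <= n < N.+1) (rep n)%:~R / n%:R =
   \sum_(0 <= n < N.+1) n%:R^-1 * (\sum_(0 <= d < N.+1 | (d %| n)%N) (chi d)%:~R) :> rat.
  rewrite big_nat [RHS]big_nat; apply: eq_bigr => n /andP[_ nN].
  case: (posnP n) => [->|n0]; first by rewrite invr0 mulr0 mul0r.
  by rewrite (rep_widen n0 nN) mulrC rmorph_sum.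
rewrite sum_dvdn ?chi0//; under eq_bigr do rewrite mulr_sumr big_mkcond/=.
rewrite exchange_big/= /harm; apply: ler_sum => e _; rewrite -big_mkcond/=.
case: (posnP e) => [->|e0]; first by rewrite big1 ?invr0// => d _; rewrite muln0 invr0 mulr0.
rewrite (eq_bigr (fun d => (e%:R^-1 : rat) * ((chi d)%:~R / d%:R))); last first.
  by move=> d _; rewrite natrM invfM; ring.
rewrite -mulr_sumr ler_piMr ?invr_ge0 ?ler0n//.
apply: le_trans (chi_harm (N %/ e)).
rewrite (big_cat_nat (n := (N %/ e).+1) (p := N.+1))//= ?ltnS ?leq_div//.
rewrite [X in _ + X]big_nat_cond [X in _ + X]big1 ?addr0 => [|d]; last first.
  by rewrite -leq_divRL// => /andP[/andP[+ _]]; rewrite ltnNge => /negPf->.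
rewrite big_nat_cond [leRHS]big_nat_cond le_eqVlt; apply/orP; left; apply/eqP.
by apply: eq_bigl => d; rewrite leq0n /= -leq_divRL// ltnS andbT andbb.
Qed.

Definition harm_free (l : seq nat) y : rat :=
  \sum_(0 <= n < y.+1 | all (fun p => ~~ (p %| n)%N) l) n%:R^-1.

(** The multiples of p in the sum on the left are p e with e again prime to the
    elements of l, so they carry at most 1/p of it. *)
Lemma harm_free_cons p l y : (0 < p)%N ->
  (1 - p%:R^-1) * harm_free l y <= harm_free (p :: l) y.
Proof.
move=> p0; rewrite mulrBl mul1r lerBlDr {1}/harm_free (bigID (fun n => ~~ (p %| n)%N))/=.
apply: lerD.
  by rewrite /harm_free /= le_eqVlt; apply/orP; left; apply/eqP/eq_bigl => n; rewrite andbC.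
rewrite (eq_bigl (fun n => (p %| n)%N && all (fun p => ~~ (p %| n)%N) l)) => [|n]; last first.
  by rewrite negbK andbC.
have le0 n : 0 <= n%:R^-1 :> rat by rewrite invr_ge0 ler0n.
apply: (@le_trans _ _ (\sum_(0 <= n < p * y.+1 | (p %| n)%N && all (fun p => ~~ (p %| n)%N) l)
  n%:R^-1)).
  rewrite [leRHS](big_cat_nat (n := y.+1))//= ?leq_pmull// lerDl.
  by apply: sumr_ge0.
rewrite big_dvdn// /harm_free mulr_sumr big_mkcond [leRHS]big_mkcond/=.
apply: ler_sum => e _; case: ifP => [/allP H|_]; last by case: ifP; rewrite ?mulr_ge0.
have -> : all (fun p => ~~ (p %| e)%N) l.
  by apply/allP => r /H; apply: contra => re; rewrite dvdn_mull.
by rewrite natrM invfM.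
Qed.

Lemma harm_free_prod l y : all (leq 1) l ->
  (\prod_(p <- l) (1 - p%:R^-1)) * harm y <= harm_free l y.
Proof.
elim: l => [|p l IH] /=; first by rewrite big_nil mul1r /harm_free /harm.
move=> /andP[p0 /IH le]; rewrite big_cons -mulrA.
apply: le_trans (harm_free_cons l y p0); apply: ler_wpM2l => //.
by rewrite subr_ge0 invf_le1 ?ltr0n ?ler1n.
Qed.

Definition split n := (0 < n)%N && all (fun p => chi p == 1) (primes n).

Lemma splitM m n : (0 < m)%N -> (0 < n)%N -> split (m * n) = split m && split n.
Proof.
move=> m0 n0; rewrite /split muln_gt0 m0 n0 /=.
apply/allP/andP => [H|[/allP Hm /allP Hn] p].
  by split; apply/allP => p pp; apply: H; rewrite primesM// pp ?orbT.
by rewrite primesM// => /orP[/Hm|/Hn].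
Qed.

Lemma split_rep n : split n ->
  rep n = \sum_(0 <= d < n.+1 | (d %| n)%N) ((0 < d)%N : nat)%:Z.
Proof.
move=> /andP[n0 /allP H]; rewrite /rep; apply: eq_bigr => d dn.
have d0 := dvdn_gt0 n0 dn; rewrite d0.
apply: (@chi_mul_ind (fun x => x = 1)) => // [a b -> ->//|p pp pd].
by apply/eqP/H; rewrite mem_primes pp n0 (dvdn_trans pd).
Qed.

(** The square on the left is a sum of 1/(d e) over pairs of integers whose
    product n has only split prime factors; for such n the number of divisors is
    rep n. *)
Lemma split_harm y :
  (\sum_(0 <= n < y.+1 | split n) n%:R^-1) ^+ 2 <= harm (y * y) :> rat.
Proof.
apply: le_trans (rep_sum (y * y)).
have le0 n : 0 <= n%:R^-1 :> rat by rewrite invr_ge0 ler0n.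
pose N := (y * y)%N.
pose g n : rat := if split n then n%:R^-1 else 0.
apply: (@le_trans _ _ (\sum_(0 <= n < N.+1)
   g n * (\sum_(0 <= d < N.+1 | (d %| n)%N) (0 < d)%N%:R))); last first.
  rewrite big_nat [leRHS]big_nat; apply: ler_sum => n /andP[_ nN]; rewrite /g.
  case: ifP => [sn|_]; last by rewrite mul0r divr_ge0 ?ler0n// ler0z rep_ge0.
  have n0 : (0 < n)%N by case/andP: sn.
  rewrite mulrC split_rep// (big_cat_nat (n := n.+1))//= [X in _ + X]big_nat_cond.
  rewrite [X in _ + X]big1 ?addr0; last first.
    by move=> d /andP[/andP[nd _]] /(dvdn_leq n0); rewrite leqNgt nd.
  by rewrite rmorph_sum.
rewrite sum_dvdn// expr2 mulr_suml big_mkcond.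
have gg d e : 0 <= g (d * e)%N by rewrite /g; case: ifP.
rewrite [leLHS](_ : _ = \sum_(0 <= d < y.+1) (if split d then d%:R^-1 *
  \sum_(0 <= n < y.+1 | split n) n%:R^-1 else 0)); last by [].
have yN : (y.+1 <= N.+1)%N by rewrite ltnS /N; nia.
rewrite [leRHS](big_cat_nat (n := y.+1))//= -[leLHS]addr0; apply: lerD; last first.
  by apply: sumr_ge0 => d _; rewrite mulr_ge0 ?ler0n// sumr_ge0.
rewrite big_nat [leRHS]big_nat; apply: ler_sum => d /andP[_ dy].
case: ifP => [sd|_]; last by rewrite mulr_ge0 ?ler0n// sumr_ge0.
have d0 : (0 < d)%N by case/andP: sd.
rewrite d0 mul1r mulr_sumr [leRHS](big_cat_nat (n := y.+1))//= -[leLHS]addr0; apply: lerD;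
  last first.
  by apply: sumr_ge0.
rewrite big_nat_cond [leRHS]big_nat_cond big_mkcond [leRHS]big_mkcond; apply: ler_sum => e _.
case: ifP => [/andP[/andP[_ ey] se]|_]; last by case: ifP.
have e0 : (0 < e)%N by case/andP: se.
have -> : (0 <= e < y.+1)%N && (d * e <= N)%N by rewrite ey /N; nia.
by rewrite /g splitM// sd se natrM invfM.
Qed.

Definition inert y := [seq p <- iota 1 y | prime p && (chi p == -1)].

(** With h and h' harmonic sums up to 2^k and 4^k, F and B the sums over integers
    free of certain primes and over integers with split prime factors only, and
    K the exponent k; the factors 1 - 1/2 and 1 - 1/3 belong to the primes 2 and
    3. *)
Lemma inert_prod_arith (R : realFieldType) (P h h' B F K : R) : 0 <= P -> 0 <= K ->
    (1 - 2^-1) * (1 - 3^-1) * P * h <= F -> F <= B -> B ^+ 2 <= h' ->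
    1 + K / 2 <= h -> h' <= 1 + (K + K) ->
  P ^+ 2 * (K + 2) <= 72.
Proof.
move=> P0 K0 H1 H2 H3 h1 h2.
have A0 : 0 <= P * (1 + K / 2) / 3.
  by apply: divr_ge0; [apply: mulr_ge0 => //; lra|lra].
have AB : P * (1 + K / 2) / 3 <= B.
  apply: le_trans H2; apply: le_trans H1.
  rewrite [leRHS](_ : _ = P * h / 3); last by field.
  by rewrite ler_pM2r ?invr_gt0// ler_wpM2l.
have H6 : (P * (1 + K / 2) / 3) ^+ 2 <= 1 + (K + K).
  apply: le_trans h2; apply: le_trans H3.
  by rewrite ler_pXn2r ?nnegrE// (le_trans A0).
have : P ^+ 2 * (K + 2) * (K + 2) <= 72 * (K + 2).
  by move: H6; rewrite !exprMn; move: (P ^+ 2) => Q; nra.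
by rewrite ler_pM2r//; lra.
Qed.

(** Were the product bounded below, the sum over integers with split prime
    factors only would be comparable to the harmonic sum H(2^k) of order k, and
    by [split_harm] its square would be at most H(4^k), which has the same
    order.  The list l contains 2 and 3 so that every other prime factor p of an
    integer has chi p = 1. *)
Lemma inert_prod k :
  ((\prod_(p <- inert (2 ^ k)) (1 - p%:R^-1)) ^+ 2) * k.+2%:R <= 72 :> rat.
Proof.
set y := (2 ^ k)%N; set l := [:: 2%N, 3%N & inert y].
have l1 : all (leq 1) l.
  by rewrite /l /=; apply/allP => p; rewrite /inert mem_filter -andbA => /and3P[/prime_gt0].
have /andP[h1 _] := harm_bounds k; have /andP[_ h2] := harm_bounds (k + k).
have H1 := harm_free_prod y l1.
have H2 : harm_free l y <= \sum_(0 <= n < y.+1 | split n) n%:R^-1.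
  rewrite /harm_free big_nat_cond [leRHS]big_nat_cond big_mkcond [leRHS]big_mkcond.
  apply: ler_sum => n _; case: ifP => [/andP[/andP[_ ny] nl]|_]; last first.
    by case: ifP; rewrite ?invr_ge0 ?ler0n.
  case: (posnP n) => [->|n0]; first by [].
  suff -> : split n by rewrite ny.
  rewrite /split n0; apply/allP => p; rewrite mem_primes => /and3P[pp _ pn].
  have /allP /(_ p) := nl; rewrite pn /=.
  have py : (p <= y)%N by rewrite -ltnS (leq_ltn_trans _ ny)// dvdn_leq.
  rewrite !inE mem_filter pp mem_iota prime_gt0//= add1n ltnS py andbT.
  case/or3P: (chiV p) => // /eqP cp.
    have := quad_char_prime0 chiP pp cp; have := prime_gt1 pp.
    by case: p {pp pn py cp} => [|[|[|[|p]]]] //= _ _ /(_ isT).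
  by rewrite cp eqxx !orbT => /(_ isT).
have H3 := split_harm y.
have yy : (y * y = 2 ^ (k + k))%N by rewrite expnD.
rewrite yy in H3; rewrite natrD in h2; rewrite /l !big_cons mulrA in H1.
rewrite -[k.+2]addn2 natrD.
have P0 : 0 <= \prod_(p <- inert y) (1 - p%:R^-1) :> rat.
  rewrite big_seq; apply: prodr_ge0 => p; rewrite mem_filter => /andP[/andP[pp _] _].
  by rewrite subr_ge0 invf_le1 ?ltr0n ?ler1n ?prime_gt0.
exact: (inert_prod_arith P0 (ler0n _ k) H1 H2 H3 h1 h2).
Qed.
End Character.

(** * A sieve by squares of primes *)

Lemma sum_crt a b (f g : nat -> bool) : (0 < a)%N -> (0 < b)%N -> coprime a b ->
  (\sum_(n < a * b) (f (n %% a) && g (n %% b)) =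
   (\sum_(i < a) f i) * (\sum_(j < b) g j))%N.
Proof.
move=> a0 b0 co; rewrite big_distrlr pair_big/=.
pose h (n : 'I_(a * b)) := (Ordinal (ltn_pmod n a0), Ordinal (ltn_pmod n b0)).
have h_inj : injective h.
  move=> m n [/eqP Ea /eqP Eb]; apply/val_inj/eqP.
  have : m = n %[mod a * b] by apply/eqP; rewrite chinese_remainder// Ea Eb.
  by rewrite !modn_small//= => ->.
have h_bij : bijective h by apply: inj_card_bij; rewrite // card_prod !card_ord.
rewrite (reindex h); last by exact: onW_bij.
by apply: eq_bigr => n _; rewrite mulnb.
Qed.

Definition sieve (s : seq nat) n := all (fun p => (p %| n) ==> (p ^ 2 %| n))%N s.

Lemma sieve_mod s n M : all (fun p => p ^ 2 %| M)%N s -> sieve s (n %% M) = sieve s n.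
Proof.
move=> /allP sM; apply: eq_in_all => p /sM pM.
have dv d : (d %| M)%N -> (d %| n %% M)%N = (d %| n)%N.
  by move=> dM; rewrite [in RHS](divn_eq n M) dvdn_addr// dvdn_mull.
by rewrite !dv//; apply: dvdn_trans pM; rewrite expnS dvdn_mulr.
Qed.

Lemma sum_sieve1 p : prime p ->
  (\sum_(n < p ^ 2) ((p %| n) ==> (p ^ 2 %| n)) = (p ^ 2 - p).+1)%N.
Proof.
move=> pp; have p0 := prime_gt0 pp.
have E : (\sum_(n < p ^ 2) ((p %| n) ==> (p ^ 2 %| n)) +
          \sum_(n < p ^ 2) (p %| n) = p ^ 2 + \sum_(n < p ^ 2) (p ^ 2 %| n))%N.
  transitivity (\sum_(n < p ^ 2) (1 + (p ^ 2 %| n)%N))%N; last first.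
    by rewrite big_split/= sum_nat_const card_ord muln1.
  rewrite -big_split /=.
  apply: eq_bigr => n _; have := @dvdn_trans (p ^ 2) p n (dvdn_exp _ (dvdnn p)).
  move=> /(_ isT).
  by case: (p %| n)%N; case: (p ^ 2 %| n)%N => //= /(_ isT).
have E1 : (\sum_(n < p ^ 2) (p %| n) = p)%N.
  rewrite -(big_mkord xpredT (fun n => (p %| n)%N : nat)) expnS expn1.
  transitivity (\sum_(0 <= n < p * p | (p %| n) && true) 1)%N.
    by rewrite [RHS]big_mkcond; apply: eq_bigr => n _; rewrite andbT; case: (p %| n)%N.
  have /= := big_dvdn (V := nat) (fun=> 1%N) xpredT p p0.
  by move=> E1; rewrite [LHS]E1 sum_nat_const_nat subn0 muln1.
have E2 : (\sum_(n < p ^ 2) (p ^ 2 %| n)%N = 1)%N.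
  have pp0 : (0 < p ^ 2)%N by rewrite expn_gt0 p0.
  rewrite (bigD1 (Ordinal pp0))//= dvdn0 big1// => -[n np] /eqP n0.
  case: (posnP n) => [E0|n1]; first by case: n0; apply: val_inj.
  by rewrite /= gtnNdvd.
have pp2 : (p <= p ^ 2)%N by rewrite -[leqLHS]expn1 leq_pexp2l.
move: E; rewrite E1 E2 => E.
by apply/eqP; rewrite -(eqn_add2r p) E addSn subnK// addn1.
Qed.

Lemma sum_sieve s : uniq s -> all prime s ->
  (\sum_(n < \prod_(p <- s) p ^ 2) sieve s n = \prod_(p <- s) (p ^ 2 - p).+1)%N.
Proof.
elim: s => [|p s IH] /=; first by rewrite !big_nil big_ord1.
move=> /andP[ps us] /andP[pp sp]; rewrite !big_cons.
have p0 : (0 < p ^ 2)%N by rewrite expn_gt0 prime_gt0.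
have M0 : (0 < \prod_(r <- s) r ^ 2)%N.
  rewrite big_seq; apply: prodn_cond_gt0 => r rs.
  by rewrite expn_gt0 prime_gt0// (allP sp).
have co : coprime (p ^ 2) (\prod_(r <- s) r ^ 2).
  rewrite big_seq; apply: (big_ind (coprime (p ^ 2)%N)) => [|a b|r rs].
  - exact: coprimen1.
  - by rewrite coprimeMr => -> ->.
  have pr : coprime p r.
    rewrite prime_coprime// dvdn_prime2 ?(allP sp r rs)//.
    by apply: contra ps => /eqP ->.
  by apply: coprimeXl; apply: coprimeXr.
rewrite -(IH us sp) -(sum_sieve1 pp).
rewrite -(sum_crt (fun n => (p %| n) ==> (p ^ 2 %| n))%N (sieve s) p0 M0 co).
apply: eq_bigr => n _; congr (nat_of_bool _); rewrite /=; congr (_ && _).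
  have := @sieve_mod [:: p] n (p ^ 2)%N; rewrite /= dvdnn => /(_ isT); rewrite !andbT => ->//.
rewrite sieve_mod//; apply/allP => r rs; rewrite (big_rem r)//= dvdn_mulr//.
Qed.

Lemma sum_periodic (F : nat -> nat) M t : (forall n, F (n %% M)%N = F n) ->
  (\sum_(0 <= n < M * t) F n = t * \sum_(0 <= n < M) F n)%N.
Proof.
move=> per; elim: t => [|t IH]; first by rewrite muln0 big_geq.
rewrite mulnS (big_cat_nat (n := M))//= ?leq_addr// mulSn; congr (_ + _)%N.
rewrite -IH -{1}[M]add0n big_addn addKn.
by apply: eq_bigr => n _; rewrite -per modnDr per.
Qed.

(** The density of [sieve s] is the product D of the 1 - 1/p + 1/p^2, and
    D^2 is at most the product of the 1 - 1/p, which [inert_prod] makes small.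
    The bound is stated with natural numbers: K times the number of survivors
    below X exceeds X by at most a constant. *)
Lemma sieve_density chi K : quad_char chi ->
  exists s C, all (fun p => prime p && (chi p == -1)) s /\
    forall X, (K * (\sum_(0 <= n < X) sieve s n) <= X + C)%N.
Proof.
move=> chiP.
(* D^4 (k + 2) <= 72, so this k gives K D <= 1. *)
pose k := (72 * K ^ 4)%N; pose s := inert chi (2 ^ k).
have := inert_prod chiP k; rewrite -/s => Ps.
have sP : all (fun p => prime p && (chi p == -1)) s.
  by apply/allP => p; rewrite mem_filter => /andP[].
have s3 p : p \in s -> (2 < p)%N.
  move=> /(allP sP) /andP[/prime_gt1]; rewrite leq_eqVlt => /predU1P[<-|//].
  by rewrite (quad_char2 chiP).
have us : uniq s by rewrite filter_uniq ?iota_uniq.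
have ps : all prime s by apply/allP => p /(allP sP) /andP[].
pose M := (\prod_(p <- s) p ^ 2)%N.
have M0 : (0 < M)%N.
  by rewrite /M big_seq; apply: prodn_cond_gt0 => r /s3 r3; rewrite expn_gt0; lia.
pose N := (\prod_(p <- s) (p ^ 2 - p).+1)%N.
have KN : (K * N <= M)%N.
  pose D : rat := \prod_(p <- s) ((p ^ 2 - p).+1%:R / (p ^ 2)%:R).
  have D0 : 0 <= D by apply: prodr_ge0 => p _; rewrite divr_ge0.
  have ND : N%:R = D * M%:R.
    rewrite /D prodf_div /N /M !natr_prod mulfVK// prodf_seq_neq0.
    by apply/allP => p /s3 p3; rewrite /= pnatr_eq0 expn_eq0; lia.
  have DP : D ^+ 2 <= \prod_(p <- s) (1 - p%:R^-1).
    rewrite /D -prodrXl big_seq [leRHS]big_seq; apply: ler_prod => p /s3 p3.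
    rewrite exprn_ge0 ?divr_ge0//=.
    have p0 : (0 : rat) < p%:R by rewrite ltr0n; lia.
    have p3' : (3 : rat) <= p%:R by rewrite ler_nat.
    have pp2 : (p <= p ^ 2)%N by rewrite -[leqLHS]expn1 leq_pexp2l//; lia.
    rewrite -addn1 natrD natrB// natrX.
    move: (p%:R : rat) p0 p3' => x x0 x3; rewrite expr_div_n ler_pdivrMr ?exprn_gt0//.
    have -> : (1 - x^-1) * x ^+ 2 ^+ 2 = x ^+ 3 * (x - 1) by field; rewrite gt_eqF.
    nra.
  have D4 : (K%:R * D) ^+ 4 <= 1.
    have D0' : 0 <= D ^+ 2 by exact: exprn_ge0.
    have : (D ^+ 2) ^+ 2 * (72 * K ^ 4)%:R <= 72 :> rat.
      apply: le_trans Ps; apply: ler_pM => //; rewrite ?exprn_ge0//.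
        by rewrite ler_pXn2r ?nnegrE// (le_trans D0').
      by rewrite ler_nat /k; lia.
    by rewrite natrM natrX -exprM exprMn; lra.
  have : K%:R * D <= 1 by rewrite -(@expr_le1 _ 4) ?mulr_ge0.
  rewrite -(ler_nat rat) natrM ND mulrA => ?; rewrite ler_piMl//.
exists s, M; split=> // X.
have per n : sieve s (n %% M) = sieve s n :> nat.
  by rewrite sieve_mod//; apply/allP => p pin; rewrite /M (big_rem p)//= dvdn_mulr.
have XM : (X <= M * (X %/ M).+1)%N by rewrite mulnC ltnW// ltn_ceil.
have : (\sum_(0 <= n < X) sieve s n <= (X %/ M).+1 * N)%N.
  rewrite /N -(sum_sieve us ps) -/M -(big_mkord xpredT (fun n => sieve s n : nat)).
  rewrite -sum_periodic// [leqRHS](big_cat_nat (n := X))//=; exact: leq_addr.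
move=> le; apply: (@leq_trans (K * ((X %/ M).+1 * N))); first by rewrite leq_mul2l le orbT.
rewrite mulnCA; apply: (@leq_trans ((X %/ M).+1 * M)); first by rewrite leq_mul2l KN orbT.
by rewrite mulSn addnC leq_add2r leq_divM.
Qed.

(** * Nonresidues modulo inert primes *)

Definition chi8 (n : nat) : int := nth 0 [:: 0; 1; 0; -1; 0; -1; 0; 1] (n %% 8).
Definition chi12 (n : nat) : int :=
  nth 0 [:: 0; 1; 0; 0; 0; -1; 0; -1; 0; 0; 0; 1] (n %% 12).

Lemma chi8M m n : chi8 (m * n) = chi8 m * chi8 n.
Proof.
rewrite /chi8 -modnMm; have := ltn_pmod m (isT : 0 < 8)%N; have := ltn_pmod n (isT : 0 < 8)%N.
by move: (m %% 8)%N (n %% 8)%N => [|[|[|[|[|[|[|[|a]]]]]]]] [|[|[|[|[|[|[|[|b]]]]]]]].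
Qed.

Lemma chi12M m n : chi12 (m * n) = chi12 m * chi12 n.
Proof.
rewrite /chi12 -modnMm; have := ltn_pmod m (isT : 0 < 12)%N; have := ltn_pmod n (isT : 0 < 12)%N.
by move: (m %% 12)%N (n %% 12)%N => [|[|[|[|[|[|[|[|[|[|[|[|a]]]]]]]]]]]]
  [|[|[|[|[|[|[|[|[|[|[|[|b]]]]]]]]]]]].
Qed.

Lemma chi8V n : [|| chi8 n == 1, chi8 n == 0 | chi8 n == -1].
Proof.
rewrite /chi8; have := ltn_pmod n (isT : 0 < 8)%N.
by move: (n %% 8)%N => [|[|[|[|[|[|[|[|b]]]]]]]].
Qed.

Lemma chi12V n : [|| chi12 n == 1, chi12 n == 0 | chi12 n == -1].
Proof.
rewrite /chi12; have := ltn_pmod n (isT : 0 < 12)%N.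
by move: (n %% 12)%N => [|[|[|[|[|[|[|[|[|[|[|[|b]]]]]]]]]]]].
Qed.

Lemma sum_char (chi : nat -> int) M : (0 < M)%N -> (forall n, chi (n %% M)%N = chi n) ->
    \sum_(0 <= d < M) chi d = 0 ->
    (forall y, (y < M)%N -> \sum_(0 <= d < y.+1) chi d <= 1) ->
  forall y, \sum_(0 <= d < y.+1) chi d <= 1.
Proof.
move=> M0 per S0 SM y; rewrite (divn_eq y M) -addnS mulnC.
have SMt t : \sum_(0 <= d < M * t) chi d = 0.
  elim: t => [|t IH]; first by rewrite muln0 big_geq.
  rewrite mulnS (big_cat_nat (n := M))//= ?leq_addr// S0 add0r -[RHS]IH.
  rewrite -{1}[M]add0n big_addn addKn.
  by apply: eq_bigr => n _; rewrite -per modnDr per.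
rewrite (big_cat_nat (n := (M * (y %/ M))%N))//= ?leq_addr// SMt add0r.
rewrite -{1}[(M * _)%N]add0n big_addn addKn.
rewrite (eq_bigr chi) => [|n _]; first exact/SM/ltn_pmod.
by rewrite -[LHS]per addnC mulnC modnMDl per.
Qed.

Lemma chi8_sum y : \sum_(0 <= d < y.+1) chi8 d <= 1.
Proof.
apply: (@sum_char chi8 8) => // [n||[|[|[|[|[|[|[|[|z]]]]]]]]//];
  by rewrite ?/chi8 ?modn_mod// unlock.
Qed.

Lemma chi12_sum y : \sum_(0 <= d < y.+1) chi12 d <= 1.
Proof.
apply: (@sum_char chi12 12) => // [n||[|[|[|[|[|[|[|[|[|[|[|[|z]]]]]]]]]]]]//];
  by rewrite ?/chi12 ?modn_mod// unlock.
Qed.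

Lemma chi8_prime0 p : prime p -> chi8 p = 0 -> (p <= 3)%N.
Proof.
move=> pp c0; have : ~~ coprime p 8.
  move: c0; rewrite -coprime_modl /chi8; have := ltn_pmod p (isT : 0 < 8)%N.
  by move: (p %% 8)%N => [|[|[|[|[|[|[|[|b]]]]]]]].
rewrite prime_coprime// negbK => p8; have : p \in primes 8 by rewrite mem_primes pp.
by rewrite inE => /eqP ->.
Qed.

Lemma chi12_prime0 p : prime p -> chi12 p = 0 -> (p <= 3)%N.
Proof.
move=> pp c0; have : ~~ coprime p 12.
  move: c0; rewrite -coprime_modl /chi12; have := ltn_pmod p (isT : 0 < 12)%N.
  by move: (p %% 12)%N => [|[|[|[|[|[|[|[|[|[|[|[|b]]]]]]]]]]]].
rewrite prime_coprime// negbK => p8; have : p \in primes 12 by rewrite mem_primes pp.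
by rewrite !inE => /orP[] /eqP ->.
Qed.

Lemma chi8P : quad_char chi8.
Proof.
split=> //; [exact: chi8M|exact: chi8V|exact: chi8_prime0|exact: chi8_sum].
Qed.

Lemma chi12P : quad_char chi12.
Proof.
split=> //; [exact: chi12M|exact: chi12V|exact: chi12_prime0|exact: chi12_sum].
Qed.

Lemma chi_inert_factor (chi : nat -> int) n : quad_char chi ->
  (0 < n)%N -> chi n = -1 -> exists p, [/\ prime p, (p %| n)%N & chi p = -1].
Proof.
move=> chiP n0 cn.
have [/hasP[p]|/hasPn H] := boolP (has (fun p => chi p == -1) (primes n)).
  by rewrite mem_primes => /and3P[pp _ pn] /eqP; exists p.
have : (chi n == 0) || (chi n == 1); last by rewrite cn.
apply: (@chi_mul_ind chi chiP (fun x => (x == 0) || (x == 1))) => //.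
  by move=> a b /orP[]/eqP-> /orP[]/eqP->.
move=> p pp pn; have /H : p \in primes n by rewrite mem_primes pp n0.
by case/or3P: (quad_charV chiP p) => /eqP ->.
Qed.

Lemma sqr_mod_parity p x (b : bool) : odd p -> ~~ (p %| x)%N ->
  exists z, [/\ (0 < z < p)%N, odd z = b & z * z = x * x %[mod p]]%N.
Proof.
move=> op px; have p0 : (0 < p)%N by case: p op {px}.
have x0 : (0 < x %% p)%N by rewrite lt0n.
have xp := ltn_pmod x p0.
have [E|E] := eqVneq (odd (x %% p)) b.
  by exists (x %% p)%N; split=> //; [rewrite x0|rewrite modnMm].
exists (p - x %% p)%N; split; first by lia.
  by rewrite oddB ?op 1?ltnW//; case: b (odd _) E => [] [].
rewrite -[in RHS]modnMm; move: (x %% p)%N x0 xp => y y0 yp.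
apply/eqP; rewrite -(eqn_modDr ((p - y) * y)) -mulnDr -mulnDl subnK 1?ltnW//.
by rewrite addnC subnK 1?ltnW// modnMl modnMr.
Qed.

(** Infinite descent on p: if D is a square modulo p then, by [step], modulo a
    smaller f with chi f = -1, hence modulo a prime factor of f with the same
    property. *)
Lemma nonres_descent (chi : nat -> int) D : quad_char chi ->
    (forall p x, prime p -> chi p = (-1)%R -> x * x = D %[mod p] ->
      exists f z, [/\ 0 < f < p, chi f = (-1)%R, D <= z * z & f %| z * z - D])%N ->
  forall p x, prime p -> chi p = -1 -> (x * x)%N <> D %[mod p].
Proof.
move=> chiP step p; have [m] := ubnP p; elim: m p => // m IH p pm x pp cp xD.
have [f [z [/andP[f0 fp] cf Dz fz]]] := step p x pp cp xD.
have [p' [pp' p'f cp']] := chi_inert_factor chiP f0 cf.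
have p'm : (p' < m)%N by rewrite -ltnS; apply: leq_trans pm; rewrite ltnS; apply: leq_trans fp;
  rewrite ltnS dvdn_leq.
apply: (IH p' p'm z pp' cp'); apply/eqP; rewrite eqn_mod_dvd//.
exact: dvdn_trans fz.
Qed.

(** An odd square root z < p of 2 gives z^2 - 2 = p f with f < p, and
    z^2 - 2 = 7 modulo 8, so chi8 p chi8 f = 1. *)
Lemma nonres8 p x : prime p -> chi8 p = -1 -> (x * x)%N <> 2 %[mod p].
Proof.
have W w : (2 < w)%N -> w = 1 %[mod 8] -> ((w - 2) %% 8 = 7)%N by lia.
apply: (nonres_descent chi8P).
move=> {}p {}x pp cp xD; have op : odd p.
  by case: (even_prime pp) cp => [->|].
have p2 : ~~ (p %| 2)%N by rewrite gtnNdvd//; have := prime_gt1 pp; lia.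
have px : ~~ (p %| x)%N.
  apply: contra p2 => px; have := congr1 (fun n => n == 0)%N xD; rewrite -!/(dvdn _ _).
  by rewrite dvdn_mulr// => /esym.
have [z [/andP[z0 zp] oz zx]] := sqr_mod_parity true op px.
have z3 : (2 < z)%N.
  case: z z0 oz zp zx => [|[|[|z]]]// _ _ _; rewrite xD => /eqP.
  by rewrite eq_sym eqn_mod_dvd// dvdn1 => /eqP p1; move: pp; rewrite p1.
have zz : (2 < z * z)%N by apply: leq_trans (leq_mul (ltnW z3) (ltnW z3)).
have zD : (p %| z * z - 2)%N by rewrite -eqn_mod_dvd ?(ltnW zz)// zx xD.
have Ef : ((z * z - 2) %/ p * p = z * z - 2)%N by rewrite divnK.
exists ((z * z - 2) %/ p)%N, z; set f := (_ %/ p)%N in Ef *.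
suff cf : chi8 f = -1.
  split; [|by []|exact: ltnW|by rewrite -Ef dvdn_mulr].
  apply/andP; split; first by case: (posnP f) Ef => // -> /eqP; rewrite eq_sym subn_eq0 leqNgt zz.
  rewrite -(ltn_pmul2r (prime_gt0 pp)) Ef; apply: leq_ltn_trans (leq_subr _ _) _.
  by apply: ltn_mul.
have : chi8 (f * p) = 1.
  rewrite Ef /chi8 W//; rewrite -modnMm; have := ltn_pmod z (isT : 0 < 8)%N.
  have : odd (z %% 8) by rewrite odd_mod.
  by move: (z %% 8)%N => [|[|[|[|[|[|[|[|b]]]]]]]].
by rewrite chi8M cp mulrN1 => /eqP; rewrite eqr_oppLR => /eqP.
Qed.

(** An even square root z < p of 3 gives z^2 - 3 = p f with f < p.  If 3 does not
    divide z then p f = 1 modulo 12.  Otherwise f = 3 g, and p g = 11 modulo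
    12. *)
Lemma nonres12 p x : prime p -> chi12 p = -1 -> (x * x)%N <> 3 %[mod p].
Proof.
have W1 w : (3 < w)%N -> w = 4 %[mod 12] -> ((w - 3) %% 12 = 1)%N by lia.
have W2 w : (0 < w)%N -> w = 0 %[mod 4] -> ((3 * w - 1) %% 12 = 11)%N by lia.
have W3 w : (w * 3 * (w * 3) - 3 = 3 * (3 * (w * w) - 1))%N by lia.
have W4 (g r : nat) : (0 < g * 3)%N -> (g * 3 < r)%N -> (0 < g < r)%N by lia.
apply: (nonres_descent chi12P).
move=> {}p {}x pp cp xD; have op : odd p.
  by case: (even_prime pp) cp => [->|].
have p3 : ~~ (p %| 3)%N.
  by rewrite dvdn_prime2//; apply: contraTneq isT => p3; move: cp; rewrite p3.
have px : ~~ (p %| x)%N.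
  apply: contra p3 => px; have := congr1 (fun n => n == 0)%N xD; rewrite -!/(dvdn _ _).
  by rewrite dvdn_mulr// => /esym.
have [z [/andP[z0 zp] oz zx]] := sqr_mod_parity false op px.
have zz : (3 < z * z)%N by case: z z0 oz {zp zx} => [|[|z]]// _ _; rewrite mulnS; lia.
have zD : (p %| z * z - 3)%N by rewrite -eqn_mod_dvd ?(ltnW zz)// zx xD.
have Ef : ((z * z - 3) %/ p * p = z * z - 3)%N by rewrite divnK.
move: Ef; set f := (_ %/ p)%N => Ef.
have f0 : (0 < f)%N by case: (posnP f) Ef => // -> /eqP; rewrite eq_sym subn_eq0 leqNgt zz.
have fp : (f < p)%N.
  rewrite -(ltn_pmul2r (prime_gt0 pp)) Ef; apply: leq_ltn_trans (leq_subr _ _) _.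
  by apply: ltn_mul.
have [/dvdnP[w Ew]|z3] := boolP (3 %| z)%N; last first.
  exists f, z; split; rewrite ?f0 ?fp ?(ltnW zz)//; last by rewrite -Ef dvdn_mulr.
  have : chi12 (f * p) = 1.
    rewrite Ef /chi12 W1//; rewrite -modnMm; have := ltn_pmod z (isT : 0 < 12)%N.
    have : ~~ odd (z %% 12) by rewrite odd_mod// oz.
    have : ~~ (3 %| z %% 12)%N by rewrite /dvdn modn_dvdm.
    by move: (z %% 12)%N => [|[|[|[|[|[|[|[|[|[|[|[|b]]]]]]]]]]]].
  by rewrite chi12M cp mulrN1 => /eqP; rewrite eqr_oppLR => /eqP.
have w0 : (0 < w)%N by case: w Ew z0 => // ->.
have Ez : (z * z - 3 = 3 * (3 * (w * w) - 1))%N by rewrite Ew W3.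
have /dvdnP[g Eg] : (3 %| f)%N.
  by rewrite -(@Gauss_dvdl _ _ p) ?Ef ?Ez ?dvdn_mulr// coprime_sym prime_coprime.
have Egp : (g * p = 3 * (w * w) - 1)%N.
  by apply/eqP; rewrite -(eqn_pmul2l (isT : 0 < 3)%N) -Ez -Ef Eg mulnA (mulnC 3).
exists g, z; split; rewrite ?(ltnW zz)//; first by apply: W4; rewrite -Eg.
  have : chi12 (g * p) = 1.
    rewrite Egp /chi12 W2 ?muln_gt0 ?w0//; rewrite -modnMm; have := ltn_pmod w (isT : 0 < 4)%N.
    have : ~~ odd (w %% 4) by rewrite odd_mod//; move: oz; rewrite Ew oddM andbT => ->.
    by move: (w %% 4)%N => [|[|[|[|b]]]].
  by rewrite chi12M cp mulrN1 => /eqP; rewrite eqr_oppLR => /eqP.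
by rewrite -Ef Eg dvdn_mulr// dvdn_mulr.
Qed.

(** * Lacunarity *)

(** If p did not divide y, then x/y would be a square root of D modulo p. *)
Lemma norm_inert D p (x y : int) : prime p -> (forall x, (x * x)%N <> D %[mod p]) ->
  (p%:Z %| x ^+ 2 - D%:Z * y ^+ 2)%Z -> ((p ^ 2)%N%:Z %| x ^+ 2 - D%:Z * y ^+ 2)%Z.
Proof.
move=> pp nr dv.
have sqE (z : int) : z ^+ 2 =
  (`|z| * `|z|)%N%:Z by rewrite PoszM -expr2 abszE real_normK// num_real.
have E : (`|x| * `|x| = D * (`|y| * `|y|) %[mod p])%N.
  by move: dv; rewrite -eqz_mod_dvd !sqE -PoszM !modz_nat => /eqP [].
have py : (p %| `|y|)%N.
  apply/negPn/negP => py; have co : coprime `|y| p by rewrite coprime_sym prime_coprime.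
  have y0 : (0 < `|y|)%N by case: (`|y|)%N py => //; rewrite dvdn0.
  have [[u v] /= uv] := coprimeP p y0 co.
  apply: (nr (u * `|x|)%N); rewrite mulnACA -modnMmr E modnMmr.
  have -> : (u * u * (D * (`|y| * `|y|)) = D * ((u * `|y|) * (u * `|y|)))%N by ring.
  have uy : (u * `|y| = 1 %[mod p])%N.
    have vu : (v * p <= u * `|y|)%N by rewrite ltnW// -subn_gt0 uv.
    by rewrite -(subnKC vu) uv modnMDl.
  by rewrite -modnMmr -[((u * _) * _ %% p)%N]modnMm uy modnMm modnMmr !muln1.
have px : (p %| `|x|)%N.
  have : (p %| D * (`|y| * `|y|))%N by rewrite dvdn_mull// dvdn_mulr.
  by rewrite {1}/dvdn -E -/(dvdn _ _) Euclid_dvdM// orbb.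
rewrite rpredB//; first by rewrite dvdzE /= abszX dvdn_exp2r.
by rewrite dvdz_mull// dvdzE /= abszX dvdn_exp2r.
Qed.

Section Lacunary.
Variables (chi : nat -> int) (D : nat).
Hypothesis chiP : quad_char chi.
Hypothesis nonres : forall p x, prime p -> chi p = -1 -> (x * x)%N <> D %[mod p].

Lemma norm_set_sieve (c A B : int) n m s : (`|c| %| 2)%N ->
    all (fun p => prime p && (chi p == -1)) s -> A * n%:Z + B = m%:Z ->
  norm_set D c A B n -> sieve s m.
Proof.
move=> c2 /allP sP Em [x [y E]]; apply/allP => p /sP /andP[pp /eqP cp]; apply/implyP => pm.
rewrite Em in E.
have co : coprime (p ^ 2) `|c|.
  apply: coprimeXl; rewrite prime_coprime//; apply: contraL c2 => pc.
  apply/negP => c2; have := dvdn_trans pc c2; rewrite dvdn_prime2// => /eqP p2.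
  by move: cp; rewrite p2 (quad_char2 chiP).
have := @norm_inert D p x y pp (fun x => @nonres p x pp cp).
rewrite E => /(_ _)/wrap[]; first by rewrite dvdzE /= abszM dvdn_mull.
by rewrite dvdzE /= abszM Gauss_dvdr.
Qed.

Lemma sum_progression (F : nat -> nat) A B X : (0 < A)%N ->
  (\sum_(0 <= n < X) F (A * n + B) <= \sum_(0 <= n < A * X + B) F n)%N.
Proof.
move=> A0; elim: X => [|X IH]; first by rewrite big_geq.
rewrite big_nat_recr//= [leqRHS](big_cat_nat (n := (A * X + B)%N))//=;
  last by rewrite leq_add2r leq_pmul2l.
apply: leq_add => //; rewrite big_ltn ?leq_addr//.
by rewrite ltn_add2r ltn_pmul2l.
Qed.

(** The exponent 0 is counted apart, since A 0 + B may be negative; the others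
    are counted by the arithmetic progression of difference A that starts at
    A + B. *)
Lemma supp_count (f : fps int) (c : int) (A : nat) (B : int) k : (`|c| %| 2)%N -> (0 < A)%N ->
    0 <= A%:Z + B -> supp (norm_set D c A%:Z B) f ->
  exists C, forall X, (k * (\sum_(0 <= n < X.+1) (coef f n != 0)) <= X + C)%N.
Proof.
move=> c2 A0 AB Sf.
have [s [C [sP sC]]] := sieve_density (A * k) chiP.
pose b := `|(A%:Z + B)%R|%N; exists (k + b + C)%N => X.
have bE : b%:Z = A%:Z + B by rewrite /b gez0_abs.
have le : (\sum_(0 <= n < X.+1) (coef f n != 0%R) <= 1 + \sum_(0 <= n < A * X + b) sieve s n)%N.
  rewrite big_nat_recl//; apply: leq_add; first exact: leq_b1.
  apply: leq_trans (sum_progression (fun n => sieve s n) b X A0).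
  apply: leq_sum => n _; case: eqVneq => //= /Sf Hn.
  by rewrite (norm_set_sieve c2 sP _ Hn)//; move: bE; lia.
apply: leq_trans (leq_mul (leqnn k) le) _.
rewrite -(leq_pmul2l A0) mulnDr muln1 mulnDr mulnA.
have := leq_pmull b A0; have := leq_pmull C A0; have := sC (A * X + b)%N.
by move: (A * k * _)%N => S; clear; lia.
Qed.

Lemma supp_lacunary (K : realType) (f : fps int) (c : int) (A : nat) (B : int) :
    (`|c| %| 2)%N -> (0 < A)%N -> 0 <= A%:Z + B -> supp (norm_set D c A%:Z B) f ->
  lacunary K f.
Proof.
move=> c2 A0 AB Sf; rewrite /lacunary; apply/cvgrPdist_lt => e e0.
have [k ke] : exists k : nat, 2 < k.+1%:R * e.
  exists (Num.Def.truncn (2 / e)); rewrite -ltr_pdivrMr//.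
  by rewrite -[_.+1]addn1 natrD; have /truncn_itv /andP[_] : 0 <= 2 / e by rewrite divr_ge0 ?ltW.
have [C HC] := supp_count k.+1 c2 A0 AB Sf.
near=> X.
have XC : (C < X)%N by near: X; exact: nbhs_infty_gt.
have X0 : 0 < X%:R :> K by rewrite ltr0n; lia.
have := HC X; rewrite big_mkord.
have -> : (\sum_(n < X.+1) (coef f n != 0))%N = #|[set n : 'I_X.+1 | coef f n != 0]%SET|.
  rewrite cardsE -sum1_card [RHS]big_mkcond; apply: eq_bigr => n _.
  by rewrite /in_mem /=; case: (_ != 0).
move=> H; rewrite sub0r normrN ger0_norm ?divr_ge0 ?ler0n// ltr_pdivrMr//.
rewrite -(ltr_pM2l (ltr0Sn K k)) mulrA.
apply: (@le_lt_trans _ _ (2 * X%:R)); last by rewrite ltr_pM2r.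
rewrite -!natrM ler_nat; apply: leq_trans H _; lia.
Unshelve. all: by end_near. Qed.
End Lacunary.

Theorem corollary1p9 (K : realType) :
  lacunary K f1 /\ lacunary K f2 /\ lacunary K f3 /\ lacunary K f4 /\
  lacunary K f5 /\ lacunary K f6 /\ lacunary K f7 /\ lacunary K f8.
Proof.
have L8 c A B f := @supp_lacunary chi8 2 chi8P nonres8 K f c A B.
have L12 c A B f := @supp_lacunary chi12 3 chi12P nonres12 K f c A B.
split; first exact: (L8 1 16%N 1 f1 erefl erefl erefl supp_f1).
split; first exact: (L8 1 16%N (-7) f2 erefl erefl erefl supp_f2).
split; first exact: (L8 1 2%N 1 f3 erefl erefl erefl supp_f3).
split; first exact: (L8 (-1) 1%N 0 f4 erefl erefl erefl supp_f4).
split; first exact: (L12 (-2) 4%N 1 f5 erefl erefl erefl supp_f5).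
split; first exact: (L12 (-1) 4%N (-1) f6 erefl erefl erefl supp_f6).
split; first exact: (L12 1 3%N 1 f7 erefl erefl erefl supp_f7).
exact: (L12 2 3%N (-1) f8 erefl erefl erefl supp_f8).
Qed.
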